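(* Let $\rho \ge 1$, let $f$ be analytic inside and on the Bernstein ellipse $\mathcal{E}_\rho$, and let $m \ge 1$ be an integer. Let $a_n$ be the Chebyshev coefficients of the first kind of $f$, let $a_n(m,\rho)$ be their $m$-point trapezoidal approximations, and let $$s_m(z) = \frac{\eta_0}{2} + \sum_{k=1}^{m-1} \eta_k T_k(z)$$ be the best polynomial approximation of degree at most $m-1$ to $f$ on and inside $\mathcal{E}_\rho$. Then for $1 \le n < m$, $$|a_n - a_n(m,\rho)| \le \frac{4}{\rho^n}\, \|f - s_m\|_{\mathcal{E}_\rho} + \frac{|\eta_{m-n}|}{\rho^m},$$ and for $n = 0$, $$|a_0 - a_0(m,\rho)| \le 4\, \|f - s_m\|_{\mathcal{E}_\rho}.$$
   Context: For $\rho \ge 1$ the Bernstein ellipse is $\mathcal{E}_\rho = \{ z \in \mathbb{C} : z = \frac12(\rho e^{i\theta} + \rho^{-1}e^{-i\theta}),\ 0 \le \theta \le 2\pi\}$ (for $\rho=1$ it degenerates to $[-1,1]$). $T_n$ is the Chebyshev polynomial of the first kind, $T_n(\cos\theta)=\cos(n\theta)$. The Chebyshev coefficients of the first kind of $f$ are $a_n = \frac{2}{\pi}\int_{-1}^1 \frac{f(x)T_n(x)}{\sqrt{1-x^2}}\,dx$, $n\ge 0$. The $m$-point trapezoidal approximation of $a_n$ is $$a_n(m,\rho) = \frac{2}{m\rho^n}\sum_{j=0}^{m-1} f\left(\tfrac12\left(\rho e^{2\pi i j/m} + \rho^{-1}e^{-2\pi i j/m}\right)\right) e^{-2\pi i jn/m}.$$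 The norm is $\|g\|_{\mathcal{E}_\rho} = \max_{z\in\mathcal{E}_\rho}|g(z)|$, which by the maximum modulus principle equals the maximum of $|g|$ over the closed region bounded by $\mathcal{E}_\rho$. Let $\mathcal{P}_{m-1}$ be the set of polynomials (complex coefficients) of degree at most $m-1$; the best approximation $s_m\in\mathcal{P}_{m-1}$ satisfies $\|f-s_m\|_{\mathcal{E}_\rho} = \inf_{s\in\mathcal{P}_{m-1}}\|f-s\|_{\mathcal{E}_\rho}$, and $\eta_0,\dots,\eta_{m-1}$ are its Chebyshev coefficients as in the displayed expansion of $s_m$ (first term halved). *)

(* Defs.v *)
From Stdlib Require Import Reals Lra Lia Psatz.
From Coquelicot Require Import Coquelicot.

Open Scope C_scope.

(** [expi t] is e^(i t). *)
Definition expi (t : R) : C := (cos t, sin t).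

Definition bernstein_point (rho t : R) : C :=
  / 2 * (RtoC rho * expi t + RtoC (/ rho) * expi (- t)).

Definition bernstein_ellipse (rho : R) (z : C) : Prop :=
  exists t : R, (0 <= t <= 2 * PI)%R /\ z = bernstein_point rho t.

(** The ellipse together with its inside, through its foci -1 and 1 and the
    length rho + 1/rho of its major axis; for rho = 1 this is the segment
    [-1,1].  See [bernstein_ellipse_foci] for the boundary. *)
Definition bernstein_region (rho : R) (z : C) : Prop :=
  (Cmod (z - 1) + Cmod (z + 1) <= rho + / rho)%R.

(** Analyticity at z: complex differentiability on a neighbourhood of z. *)
Definition analytic_at (f : C -> C) (z : C) : Prop :=
  locally z (fun w : C => ex_derive (K := C_AbsRing) (V := C_NormedModule) f w).

Fixpoint cheb_pair (n : nat) (z : C) : C * C :=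
  match n with
  | O => (RtoC 1, z)
  | S k => let (p, q) := cheb_pair k z in (q, 2 * z * q - p)
  end.

(** Three-term recurrence; [chebT_cos] gives T_n(cos t) = cos (n t). *)
Definition chebT (n : nat) (z : C) : C := fst (cheb_pair n z).

(** The integrand is singular at both end points, so the integral is an
    improper Riemann integral at -1 and at 1. *)
Definition cheb_coef (f : C -> C) (n : nat) : C :=
  RtoC (2 / PI) *
  RInt_gen (V := C_R_CompleteNormedModule)
    (fun x : R => f (RtoC x) * chebT n (RtoC x) / RtoC (sqrt (1 - x ^ 2)))
    (at_right (-1)) (at_left 1).

Definition cheb_coef_trap (f : C -> C) (m : nat) (rho : R) (n : nat) : C :=
  RtoC (2 / (INR m * rho ^ n)) *
  sum_n_m
    (fun j : nat =>
       f (bernstein_point rho (2 * PI * INR j / INR m)) *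
       expi (- (2 * PI * INR j * INR n / INR m)))
    0 (m - 1).

(** The maximum of |g| over the ellipse, as a supremum: the two agree for g
    continuous on the ellipse. *)
Definition ellipse_norm (rho : R) (g : C -> C) : R :=
  real (Lub_Rbar (fun r : R =>
    exists z : C, bernstein_ellipse rho z /\ r = Cmod (g z))).

Definition poly_deg_le (d : nat) (p : C -> C) : Prop :=
  exists c : nat -> C,
    forall z : C, p z = sum_n_m (fun k : nat => c k * z ^ k) 0 d.

Definition best_approx (rho : R) (d : nat) (f s : C -> C) : Prop :=
  poly_deg_le d s /\
  Finite (ellipse_norm rho (fun z => f z - s z)) =
  Glb_Rbar (fun r : R =>
    exists t : C -> C,
      poly_deg_le d t /\ r = ellipse_norm rho (fun z => f z - t z)).

Lemma chebT_SS (n : nat) (z : C) :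
  chebT (S (S n)) z = 2 * z * chebT (S n) z - chebT n z.
Proof.
unfold chebT; simpl; destruct (cheb_pair n z) as [p q]; reflexivity.
Qed.

Lemma chebT_cos (n : nat) (t : R) :
  chebT n (RtoC (cos t)) = RtoC (cos (INR n * t)).
Proof.
cut (chebT n (RtoC (cos t)) = RtoC (cos (INR n * t)) /\
     chebT (S n) (RtoC (cos t)) = RtoC (cos (INR (S n) * t))).
{ now intros [H _]. }
induction n as [|n [IH0 IH1]].
- split; unfold chebT; simpl.
  + now rewrite Rmult_0_l, cos_0.
  + now rewrite Rmult_1_l.
- split; [exact IH1|].
  rewrite chebT_SS, IH0, IH1, <- !RtoC_mult, <- RtoC_minus; f_equal.
  rewrite !S_INR.
  replace ((INR n + 1 + 1) * t)%R with ((INR n + 1) * t + t)%R by ring.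
  replace (INR n * t)%R with ((INR n + 1) * t - t)%R by ring.
  rewrite cos_plus, cos_minus; ring.
Qed.

Lemma bernstein_point_coord (rho t : R) :
  bernstein_point rho t =
  ((rho + / rho) / 2 * cos t, (rho - / rho) / 2 * sin t)%R.
Proof.
unfold bernstein_point, expi.
rewrite <- RtoC_inv by lra.
unfold Cmult, Cplus, RtoC; simpl.
rewrite cos_neg, sin_neg.
f_equal; generalize (/ rho)%R; intro r; field.
Qed.

Lemma bernstein_ellipse_foci (rho : R) (z : C) : (1 <= rho)%R ->
  bernstein_ellipse rho z <->
  (Cmod (z - 1) + Cmod (z + 1) = rho + / rho)%R.
Proof.
intros Hrho.
set (a := ((rho + / rho) / 2)%R); set (b := ((rho - / rho) / 2)%R).
assert (Hinv : (0 < / rho <= 1)%R).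
{ split; [apply Rinv_0_lt_compat; lra|].
  replace 1%R with (/ 1)%R by apply Rinv_1; apply Rinv_le_contravar; lra. }
assert (Hri : (rho * / rho = 1)%R) by (field; lra).
assert (Hab : (b * b = a * a - 1)%R) by (unfold a, b; clear -Hri; lra).
assert (Hb : (0 <= b)%R) by (unfold b; lra).
assert (Ha : (1 <= a)%R) by (unfold a in *; nra).
replace (rho + / rho)%R with (2 * a)%R by (unfold a; lra).
assert (mod_ge0 : forall (w : C) (r : R), (0 <= r)%R ->
  (fst w * fst w + snd w * snd w = r * r)%R -> Cmod w = r).
{ intros w r Hr Hw; unfold Cmod.
  replace (fst w ^ 2 + snd w ^ 2)%R with (r * r)%R by (simpl; lra).
  now apply sqrt_square. }
assert (mod_sqr : forall w : C,
  (Cmod w * Cmod w = fst w * fst w + snd w * snd w)%R).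
{ intros [u v]; unfold Cmod; rewrite sqrt_sqrt; simpl; [ring|].
  pose proof (Rle_0_sqr u); pose proof (Rle_0_sqr v); unfold Rsqr in *; lra. }
split.
- intros [t [_ ->]]; rewrite bernstein_point_coord; fold a b.
  pose proof (COS_bound t) as Hc.
  pose proof (sin2_cos2 t) as Hsc; unfold Rsqr in Hsc.
  assert (Hbs : (b * sin t * (b * sin t)
                 = (a * a - 1) * (1 - cos t * cos t))%R).
  { replace (1 - cos t * cos t)%R with (sin t * sin t)%R by lra.
    rewrite <- Hab; ring. }
  rewrite (mod_ge0 _ (a - cos t)%R), (mod_ge0 _ (a + cos t)%R);
    try lra; simpl; nra.
- destruct z as [x y]; intros Hz.
  pose proof (mod_sqr ((x, y) - 1)) as Hm.
  pose proof (mod_sqr ((x, y) + 1)) as Hp.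
  pose proof (Cmod_ge_0 ((x, y) - 1)) as Hm0.
  pose proof (Cmod_ge_0 ((x, y) + 1)) as Hp0.
  set (p := Cmod ((x, y) + 1)) in *; set (q := Cmod ((x, y) - 1)) in *.
  simpl in Hm, Hp.
  set (c := ((p - q) / 2)%R).
  assert (Ep : p = (a + c)%R) by (unfold c; lra).
  assert (Eq : q = (a - c)%R) by (unfold c; lra).
  clearbody c p q; subst p q.
  assert (Hx : x = (a * c)%R) by nra.
  assert (Hy : (y * y = (a * a - 1) * (1 - c * c))%R) by (subst x; nra).
  assert (Hc : (-1 <= c <= 1)%R).
  { destruct (Req_dec a 1) as [->|Na]; [lra|].
    assert (0 <= 1 - c * c)%R; [|nra].
    apply Rnot_lt_le; intro; pose proof (Rle_0_sqr y); unfold Rsqr in *.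
    assert (0 < a * a - 1)%R by nra; nra. }
  pose proof (acos_bound c) as Hac.
  set (r := sqrt (1 - c * c)).
  assert (Hr0 : (0 <= r)%R) by apply sqrt_pos.
  assert (Hrr : (r * r = 1 - c * c)%R) by (apply sqrt_sqrt; nra).
  assert (Hsin : sin (acos c) = r) by (now apply sin_acos).
  assert (Hyb : (y * y = (b * r) * (b * r))%R) by
    (rewrite Hy, <- Hrr, <- Hab; ring).
  assert (Hbr : (0 <= b * r)%R) by nra.
  destruct (Rle_lt_dec 0 y) as [Hy0|Hy0].
  + exists (acos c); split; [lra|].
    rewrite bernstein_point_coord; fold a b.
    rewrite cos_acos, Hsin by assumption; f_equal; nra.
  + exists (2 * PI - acos c)%R; split; [lra|].
    rewrite bernstein_point_coord; fold a b.
    replace (2 * PI - acos c)%R with (- acos c + 2 * INR 1 * PI)%R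
      by (simpl; ring).
    rewrite cos_period, sin_period, cos_neg, sin_neg, cos_acos, Hsin
      by assumption.
    f_equal; nra.
Qed.

(* Main.v *)
(** The substitution [x = cos t] writes [a_n] as [(2 / rho^n)] times the mean over
    a period of [f (bernstein_point rho t) e^(-i n t)], first for [rho = 1] and then
    for every [rho] by Cauchy's theorem: in the coordinate [w = log u] of the Joukowski
    map [z = (u + 1/u) / 2] the integrand is holomorphic on a rectangle and
    [2 pi i]-periodic.  Since [f] is only assumed complex differentiable, this uses
    Goursat's bisection.  So [a_n - a_n(m, rho)] is [2 / rho^n] times the error of the
    trapezoidal rule for that function.  The error is linear, is at most twice the sup
    norm (used on [f - s]), and vanishes on [e^(i p t)] unless [m] divides [p <> 0]
    (used on [s], where only the mode [p = - m] coming from [T_(m-n)] survives). *)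

Require Import Defs.
From Stdlib Require Import Reals Lra Lia Psatz ZArith.
From Coquelicot Require Import Coquelicot.

Local Open Scope C_scope.

(** * Exponentials and Chebyshev polynomials *)

(** Complex differentiability gives a priori neither a power series nor a continuous derivative,
    hence the bisection. The logarithmic coordinate avoids the inverse Joukowski map, which branches
    at -1 and 1: the forward map is entire in [w], the segment [-1,1] is the image of the side
    [Re w = 0], and for [rho = 1] the rectangle merely has width 0. The constant 4 is 2 from the
    normalisation times 2 from bounding the mean and the node average separately. On the ellipse
    [T_k] has the modes k and -k with weights [rho^k / 2] and [rho^(-k) / 2]. After the twist by
    [e^(-i n t)], the bound |k - n| < m keeps the growing weight from aliasing; the decaying one, at
    k = m - n, contributes [2 / rho^n] times [rho^(-(m-n)) / 2], which is [1 / rho^m]. For n = 0 the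
    aliasing index would be m, above the degree of [s]. *)

Lemma expi_0 : expi 0 = 1.
Proof. unfold expi; now rewrite cos_0, sin_0. Qed.

Lemma expi_plus (a b : R) : expi (a + b) = expi a * expi b.
Proof.
unfold expi, Cmult; simpl; rewrite cos_plus, sin_plus; f_equal; ring.
Qed.

Lemma expi_mul_opp (t : R) : expi t * expi (- t) = 1.
Proof. now rewrite <- expi_plus, Rplus_opp_r, expi_0. Qed.

Lemma Cmod_expi (t : R) : Cmod (expi t) = 1%R.
Proof.
unfold Cmod, expi; cbn [fst snd].
replace (cos t ^ 2 + sin t ^ 2)%R with 1%R; [apply sqrt_1|].
rewrite <- (sin2_cos2 t); unfold Rsqr; ring.
Qed.

Lemma expi_pow (t : R) (n : nat) : expi t ^ n = expi (INR n * t).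
Proof.
induction n as [|n IH].
- simpl; now rewrite Rmult_0_l, expi_0.
- rewrite Cpow_S, IH, <- expi_plus, S_INR; f_equal; ring.
Qed.

Lemma expi_2PI_INR (n : nat) : expi (2 * PI * INR n) = 1.
Proof.
replace (2 * PI * INR n)%R with (0 + 2 * INR n * PI)%R by ring.
unfold expi; rewrite cos_period, sin_period; apply expi_0.
Qed.

Lemma expi_2PI_Z (p : Z) : expi (IZR p * (2 * PI)) = 1.
Proof.
destruct (Z.le_gt_cases 0 p) as [Hp|Hp].
- rewrite <- (Z2Nat.id p), <- INR_IZR_INZ, Rmult_comm by lia.
  apply expi_2PI_INR.
- pose proof (expi_mul_opp (IZR p * (2 * PI))) as H.
  replace (- (IZR p * (2 * PI)))%R with (2 * PI * INR (Z.to_nat (- p)))%R in H.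
  + now rewrite expi_2PI_INR, Cmult_1_r in H.
  + rewrite INR_IZR_INZ, Z2Nat.id, opp_IZR by lia; ring.
Qed.

Lemma expi_eq_1 (x : R) : expi (2 * PI * x) = 1 -> exists k : Z, x = IZR k.
Proof.
intros H; apply (f_equal fst) in H; unfold expi in H; simpl in H.
replace (2 * PI * x)%R with (2 * (PI * x))%R in H by ring.
(* The real part suffices: cos (2 PI x) = 1 - 2 sin^2 (PI x), so sin (PI x) vanishes. *)
rewrite cos_2a_sin in H.
assert (Hs : sin (PI * x) = 0%R) by nra.
destruct (sin_eq_0_0 _ Hs) as [k Hk]; exists k.
pose proof PI_RGT_0; apply (Rmult_eq_reg_l PI); lra.
Qed.

(** Multiplication by [w - 1] telescopes the geometric sum to [w ^ m - 1]. *)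
Lemma sum_root_of_unity (m : nat) (w : C) :
  w <> 1 -> w ^ m = 1 -> (1 <= m)%nat ->
  sum_n_m (fun j : nat => w ^ j) 0 (m - 1) = RtoC 0 :> C.
Proof.
intros Hw Hwm Hm.
assert (E : forall k, (w - 1) * sum_n_m (fun j : nat => w ^ j) 0 k = w ^ (S k) - 1 :> C).
{ induction k as [|k IH].
  - rewrite sum_n_n, Cpow_1_r; simpl; ring.
  - rewrite sum_n_Sm by lia; change plus with Cplus.
    rewrite Cmult_plus_distr_l, IH, !Cpow_S; ring. }
specialize (E (m - 1)%nat).
replace (S (m - 1)) with m in E by lia.
rewrite Hwm in E.
replace (sum_n_m (fun j : nat => w ^ j) 0 (m - 1)) with
  (/ (w - 1) * ((w - 1) * sum_n_m (fun j : nat => w ^ j) 0 (m - 1))).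
- rewrite E; ring.
- field; intros H; apply Hw; replace w with (w - 1 + 1) by ring; rewrite H; ring.
Qed.

(** Discrete orthogonality: the values at the nodes are the powers of e^(2 pi i p / m), an m-th root
    of unity that equals 1 only when m divides p. *)
Lemma sum_expi_nodes (m : nat) (p : Z) : (1 <= m)%nat ->
  ~ (Z.of_nat m | p)%Z ->
  sum_n_m (fun j : nat => expi (IZR p * (2 * PI * INR j / INR m))) 0 (m - 1) = RtoC 0 :> C.
Proof.
intros Hm Hp.
assert (Hm0 : INR m <> 0%R) by (apply not_0_INR; lia).
rewrite (sum_n_m_ext _ (fun j => expi (2 * PI * (IZR p / INR m)) ^ j)).
- apply sum_root_of_unity; [| |assumption].
  + intros H; apply Hp; destruct (expi_eq_1 _ H) as [k Hk]; exists k.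
    apply eq_IZR; rewrite mult_IZR, <- INR_IZR_INZ, <- Hk; field; assumption.
  + rewrite expi_pow, <- (expi_2PI_Z p); f_equal; field; assumption.
- intros j; rewrite expi_pow; f_equal; field; assumption.
Qed.

Lemma sum_expi_nodes_dvd (m : nat) (p : Z) : (1 <= m)%nat ->
  (Z.of_nat m | p)%Z ->
  sum_n_m (fun j : nat => expi (IZR p * (2 * PI * INR j / INR m))) 0 (m - 1)
  = RtoC (INR m) :> C.
Proof.
intros Hm [k ->].
assert (Hm0 : INR m <> 0%R) by (apply not_0_INR; lia).
rewrite (sum_n_m_ext _ (fun _ => RtoC 1)).
- replace (m - 1)%nat with (pred m) by lia.
  replace m with (S (pred m)) at 2 by lia.
  generalize (pred m); intros q; induction q as [|q IH].
  + now rewrite sum_n_n.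
  + rewrite sum_n_Sm, IH, (S_INR (S q)), RtoC_plus by lia; reflexivity.
- intros j.
  rewrite <- (expi_2PI_Z (k * Z.of_nat j)); f_equal.
  rewrite !mult_IZR, <- !INR_IZR_INZ; field; assumption.
Qed.

(** Two variables with product 1 replace u and 1/u, so no division enters: each step of the
    recurrence is a polynomial identity up to a multiple of [u * v - 1]. *)
Lemma chebT_joukowski (k : nat) (u v : C) :
  u * v = 1 -> chebT k (/ 2 * (u + v)) = / 2 * (u ^ k + v ^ k).
Proof.
intros Huv.
cut (chebT k (/ 2 * (u + v)) = / 2 * (u ^ k + v ^ k) /\
     chebT (S k) (/ 2 * (u + v)) = / 2 * (u ^ S k + v ^ S k)).
{ now intros [H _]. }
assert (H2 : RtoC 2 <> 0) by (intros H; apply RtoC_inj in H; lra).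
induction k as [|k [IH0 IH1]].
- split; unfold chebT; simpl; field.
- split; [exact IH1|].
  rewrite chebT_SS, IH0, IH1, !Cpow_S.
  replace (2 * (/ 2 * (u + v)) * (/ 2 * (u * u ^ k + v * v ^ k)) - / 2 * (u ^ k + v ^ k))
    with (/ 2 * (u * (u * u ^ k) + v * (v * v ^ k))
          + / 2 * ((u * v - 1) * (u ^ k + v ^ k))) by (field; assumption).
  rewrite Huv; ring.
Qed.

Lemma chebT_bernstein_mode (k n : nat) (rho t : R) : rho <> 0%R ->
  chebT k (bernstein_point rho t) * expi (- (INR n * t)) =
  / 2 * (RtoC (rho ^ k) * expi (IZR (Z.of_nat k - Z.of_nat n) * t)
         + RtoC (/ rho ^ k) * expi (IZR (- (Z.of_nat k + Z.of_nat n)) * t)).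
Proof.
intros Hr; unfold bernstein_point; rewrite chebT_joukowski.
- rewrite !Cpow_mult_l, !expi_pow, <- !RtoC_pow, pow_inv.
  rewrite minus_IZR, opp_IZR, plus_IZR, <- !INR_IZR_INZ.
  replace ((INR k - INR n) * t)%R with (INR k * t + - (INR n * t))%R by ring.
  replace (- (INR k + INR n) * t)%R with (INR k * - t + - (INR n * t))%R by ring.
  rewrite !expi_plus; ring.
- replace (RtoC rho * expi t * (RtoC (/ rho) * expi (- t))) with
    (RtoC (rho * / rho) * (expi t * expi (- t))) by (rewrite RtoC_mult; ring).
  now rewrite expi_mul_opp, Rinv_r, Cmult_1_r.
Qed.

(** * Complex-valued functions of a real or complex variable *)

(** [C] is used with two structures: a real normed module for paths and integrals, and a module over
    itself for complex derivatives. *)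
Local Notation continuousC := (continuous (T := R_UniformSpace) (U := C_R_CompleteNormedModule)).
Local Notation is_RIntC := (is_RInt (V := C_R_CompleteNormedModule)).
Local Notation ex_RIntC := (ex_RInt (V := C_R_CompleteNormedModule)).
Local Notation RIntC := (RInt (V := C_R_CompleteNormedModule)).
Local Notation is_deriveC := (is_derive (K := C_AbsRing) (V := AbsRing_NormedModule C_AbsRing)).

(** The real structure on [C] is a product whose balls are squares; the equivalence of [locally]
    with the norm neighbourhoods turns them into discs for [Cmod]. *)
Lemma continuousC_eps (f : R -> C) (x : R) :
  continuousC f x <->
  (forall eps : R, (0 < eps)%R -> exists delta : R, (0 < delta)%R /\
     forall y : R, (Rabs (y - x) < delta)%R -> (Cmod (f y - f x) < eps)%R).
Proof.
unfold continuous; split.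
- intros H eps Heps.
  assert (L : locally (T := C_R_CompleteNormedModule) (f x)
                (fun z => (Cmod (z - f x) < eps)%R)).
  { apply (locally_le_locally_norm (V := C_R_NormedModule)); exists (mkposreal eps Heps).
    intros y Hy; unfold ball_norm in Hy; simpl in Hy.
    rewrite Cmod_norm; exact Hy. }
  destruct (H _ L) as [d Hd]; exists d; split; [apply cond_pos|].
  intros y Hy; apply Hd; exact Hy.
- intros H P HP.
  apply (locally_norm_le_locally (V := C_R_NormedModule)) in HP; destruct HP as [eps HP].
  destruct (H eps (cond_pos eps)) as [d [Hd0 Hd]].
  exists (mkposreal d Hd0); intros y Hy; apply HP.
  unfold ball_norm; specialize (Hd y Hy); rewrite Cmod_norm in Hd; exact Hd.
Qed.

Lemma continuousC_pair (f : R -> C) (x : R) :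
  continuous (fun t => fst (f t)) x -> continuous (fun t => snd (f t)) x ->
  continuousC f x.
Proof.
intros H1 H2 P [eps HP].
destruct (H1 _ (locally_ball _ eps)) as [d1 Hd1].
destruct (H2 _ (locally_ball _ eps)) as [d2 Hd2].
exists (mkposreal _ (Rmin_pos _ _ (cond_pos d1) (cond_pos d2))).
intros y Hy; apply HP; split.
- apply Hd1; unfold ball in *; simpl in *; eapply Rlt_le_trans; [exact Hy|apply Rmin_l].
- apply Hd2; unfold ball in *; simpl in *; eapply Rlt_le_trans; [exact Hy|apply Rmin_r].
Qed.

Lemma continuousC_fst (f : R -> C) (x : R) :
  continuousC f x -> continuous (fun t => fst (f t)) x.
Proof.
intros H; apply (continuous_comp f fst); [exact H|].
destruct (f x); apply continuous_fst.
Qed.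

Lemma continuousC_snd (f : R -> C) (x : R) :
  continuousC f x -> continuous (fun t => snd (f t)) x.
Proof.
intros H; apply (continuous_comp f snd); [exact H|].
destruct (f x); apply continuous_snd.
Qed.

Lemma continuousC_mult (f g : R -> C) (x : R) :
  continuousC f x -> continuousC g x -> continuousC (fun t => f t * g t) x.
Proof.
intros Hf Hg.
pose proof (continuousC_fst _ _ Hf) as Hf1; pose proof (continuousC_snd _ _ Hf) as Hf2.
pose proof (continuousC_fst _ _ Hg) as Hg1; pose proof (continuousC_snd _ _ Hg) as Hg2.
apply continuousC_pair; simpl.
- apply (continuous_minus (V := R_NormedModule)); now apply (continuous_mult (K := R_AbsRing)).
- apply (continuous_plus (V := R_NormedModule)); now apply (continuous_mult (K := R_AbsRing)).
Qed.

Lemma continuousC_expi (c t : R) : continuousC (fun t => expi (c * t)) t.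
Proof.
apply continuousC_pair; unfold expi; simpl;
  apply (ex_derive_continuous (V := R_NormedModule)); auto_derive; exact I.
Qed.

Lemma is_RIntC_Cmult (f : R -> C) (a b : R) (c l : C) :
  is_RIntC f a b l -> is_RIntC (fun t => c * f t) a b (c * l).
Proof.
intros H.
pose proof (is_RInt_fct_extend_fst (U := R_NormedModule) (V := R_NormedModule) f a b l H) as H1.
pose proof (is_RInt_fct_extend_snd (U := R_NormedModule) (V := R_NormedModule) f a b l H) as H2.
apply (is_RInt_fct_extend_pair (U := R_NormedModule) (V := R_NormedModule)); simpl.
- apply (is_RInt_minus (V := R_NormedModule)); now apply (is_RInt_scal (V := R_NormedModule)).
- apply (is_RInt_plus (V := R_NormedModule)); now apply (is_RInt_scal (V := R_NormedModule)).
Qed.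

Lemma is_RIntC_bound (f : R -> C) (a b M : R) (l : C) :
  (a <= b)%R -> (forall x, (a <= x <= b)%R -> (Cmod (f x) <= M)%R) ->
  is_RIntC f a b l -> (Cmod l <= (b - a) * M)%R.
Proof.
intros Hab HM H; rewrite Cmod_norm.
apply (norm_RInt_le_const (V := C_R_NormedModule) f a b l M Hab); [|exact H].
intros x Hx; specialize (HM x Hx); rewrite Cmod_norm in HM; exact HM.
Qed.

Lemma is_RIntC_Cderive (f df : R -> C) (a b : R) :
  (forall x, is_derive (fun t => fst (f t)) x (fst (df x))) ->
  (forall x, is_derive (fun t => snd (f t)) x (snd (df x))) ->
  (forall x, continuousC df x) ->
  is_RIntC df a b (f b - f a).
Proof.
intros H1 H2 Hc.
apply (is_RInt_fct_extend_pair (U := R_NormedModule) (V := R_NormedModule)).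
- apply (is_RInt_derive (V := R_CompleteNormedModule) (fun t => fst (f t))); intros; [apply H1|].
  now apply continuousC_fst.
- apply (is_RInt_derive (V := R_CompleteNormedModule) (fun t => snd (f t))); intros; [apply H2|].
  now apply continuousC_snd.
Qed.

(** * Complex differentiability *)

Lemma is_deriveC_eps (h : C -> C) (z l : C) :
  is_deriveC h z l ->
  forall eps : R, (0 < eps)%R -> exists delta : R, (0 < delta)%R /\
    forall w : C, (Cmod (w - z) < delta)%R ->
      (Cmod (h w - h z - l * (w - z)) <= eps * Cmod (w - z))%R.
Proof.
intros [_ H] eps Heps.
specialize (H z (fun P HP => HP) (mkposreal eps Heps)).
destruct H as [d Hd]; exists d; split; [apply cond_pos|].
intros w Hw; specialize (Hd w Hw).
rewrite (Cmult_comm l); exact Hd.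
Qed.

Lemma is_deriveC_of_eps (h : C -> C) (z l : C) :
  (forall eps : R, (0 < eps)%R -> exists delta : R, (0 < delta)%R /\
    forall w : C, (Cmod (w - z) < delta)%R ->
      (Cmod (h w - h z - l * (w - z)) <= eps * Cmod (w - z))%R) ->
  is_deriveC h z l.
Proof.
intros H; split; [apply is_linear_scal_l|].
intros x Hx.
apply (is_filter_lim_locally_unique (V := AbsRing_NormedModule C_AbsRing)) in Hx; subst x.
intros eps; destruct (H eps (cond_pos eps)) as [d [Hd0 Hd]].
exists (mkposreal d Hd0); intros w Hw; specialize (Hd w Hw).
rewrite (Cmult_comm l) in Hd; exact Hd.
Qed.

Lemma continuousC_comp_deriveC (h : C -> C) (g : R -> C) (x : R) (l : C) :
  is_deriveC h (g x) l -> continuousC g x -> continuousC (fun t => h (g t)) x.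
Proof.
intros Hh Hg; apply continuousC_eps; intros eps Heps.
(* Differentiability with tolerance 1 gives |h w - h (g x)| <= (1 + |l|) |w - g x| near [g x], which
   is enough for continuity. *)
destruct (is_deriveC_eps _ _ _ Hh 1 Rlt_0_1) as [d [Hd0 Hd]].
pose proof (Cmod_ge_0 l) as Hl.
set (e' := Rmin d (eps / (1 + Cmod l))).
assert (He' : (0 < e')%R).
{ apply Rmin_pos; [assumption|]; apply Rdiv_lt_0_compat; lra. }
destruct (proj1 (continuousC_eps _ _) Hg e' He') as [r [Hr0 Hr]].
exists r; split; [assumption|]; intros y Hy; specialize (Hr y Hy).
assert (Hw : (Cmod (g y - g x) < d)%R) by (eapply Rlt_le_trans; [exact Hr|apply Rmin_l]).
assert (Hw' : (Cmod (g y - g x) < eps / (1 + Cmod l))%R)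
  by (eapply Rlt_le_trans; [exact Hr|apply Rmin_r]).
specialize (Hd _ Hw).
replace (h (g y) - h (g x)) with
  (h (g y) - h (g x) - l * (g y - g x) + l * (g y - g x)) by ring.
eapply Rle_lt_trans; [apply Cmod_triangle|]; rewrite Cmod_mult.
apply (Rmult_lt_compat_r (1 + Cmod l)) in Hw'; [|lra].
replace (eps / (1 + Cmod l) * (1 + Cmod l))%R with eps in Hw' by (field; lra).
lra.
Qed.

Definition Cdiff_at (h : C -> C) (z : C) : Prop := exists l : C, is_deriveC h z l.

Lemma Cdiff_const (c z : C) : Cdiff_at (fun _ => c) z.
Proof. exists (RtoC 0); apply @is_derive_const. Qed.

Lemma Cdiff_id (z : C) : Cdiff_at (fun w => w) z.
Proof. exists (RtoC 1); apply (is_derive_id (K := C_AbsRing)). Qed.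

Lemma Cdiff_plus (f g : C -> C) (z : C) :
  Cdiff_at f z -> Cdiff_at g z -> Cdiff_at (fun w => f w + g w) z.
Proof.
intros [l Hl] [k Hk]; exists (l + k).
exact (is_derive_plus (V := AbsRing_NormedModule C_AbsRing) f g z l k Hl Hk).
Qed.

Lemma Cdiff_mult (f g : C -> C) (z : C) :
  Cdiff_at f z -> Cdiff_at g z -> Cdiff_at (fun w => f w * g w) z.
Proof.
intros [l Hl] [k Hk]; exists (l * g z + f z * k).
exact (is_derive_mult (K := C_AbsRing) f g z l k Hl Hk Cmult_comm).
Qed.

Lemma Cdiff_comp (f g : C -> C) (z : C) :
  Cdiff_at f (g z) -> Cdiff_at g z -> Cdiff_at (fun w => f (g w)) z.
Proof.
intros [l Hl] [k Hk]; exists (k * l).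
exact (is_derive_comp (K := C_AbsRing) (V := AbsRing_NormedModule C_AbsRing) f g z l k Hl Hk).
Qed.

Lemma Cdiff_scal (c : C) (f : C -> C) (z : C) :
  Cdiff_at f z -> Cdiff_at (fun w => c * f w) z.
Proof. intros H; apply Cdiff_mult; [apply Cdiff_const|exact H]. Qed.

Lemma Cdiff_ext (f g : C -> C) (z : C) :
  (forall w, f w = g w) -> Cdiff_at f z -> Cdiff_at g z.
Proof.
intros E [l Hl]; exists l.
exact (is_derive_ext (V := AbsRing_NormedModule C_AbsRing) f g z l E Hl).
Qed.

(** * Goursat's theorem on rectangles *)

(** The counterclockwise contour integral of [h] along the boundary, with dz = i dy on the vertical
    sides. *)
Definition rect_int (h : C -> C) (a b c d : R) : C :=
  RIntC (fun x => h (x, c)) a b - RIntC (fun x => h (x, d)) a b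
  + Ci * (RIntC (fun y => h (b, y)) c d - RIntC (fun y => h (a, y)) c d).

Definition holo_rect (h : C -> C) (a b c d : R) : Prop :=
  forall x y : R, (a <= x <= b)%R -> (c <= y <= d)%R ->
    Cdiff_at h (x, y).

Lemma Cmod_le_Rabs (x y : R) : (Cmod (x, y) <= Rabs x + Rabs y)%R.
Proof.
replace (x, y) with (RtoC x + Ci * RtoC y)
  by (unfold Cplus, Cmult, Ci, RtoC; simpl; f_equal; ring).
eapply Rle_trans; [apply Cmod_triangle|].
rewrite Cmod_mult, !Cmod_R, Cmod_Ci; lra.
Qed.

Lemma ex_RIntC_hor (h : C -> C) (a b c d a' b' y : R) :
  holo_rect h a b c d -> (a <= a')%R -> (a' <= b')%R -> (b' <= b)%R -> (c <= y <= d)%R ->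
  ex_RIntC (fun x => h (x, y)) a' b'.
Proof.
intros H Ha Hab Hb Hy; apply ex_RInt_continuous; intros x Hx.
rewrite Rmin_left, Rmax_right in Hx by lra.
destruct (H x y) as [l Hl]; [lra|lra|].
apply (continuousC_comp_deriveC h (fun t => (t, y)) x l Hl).
apply continuousC_pair; simpl; [apply continuous_id|apply continuous_const].
Qed.

Lemma ex_RIntC_vert (h : C -> C) (a b c d c' d' x : R) :
  holo_rect h a b c d -> (c <= c')%R -> (c' <= d')%R -> (d' <= d)%R -> (a <= x <= b)%R ->
  ex_RIntC (fun y => h (x, y)) c' d'.
Proof.
intros H Ha Hab Hb Hx; apply ex_RInt_continuous; intros y Hy.
rewrite Rmin_left, Rmax_right in Hy by lra.
destruct (H x y) as [l Hl]; [lra|lra|].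
apply (continuousC_comp_deriveC h (fun t => (x, t)) y l Hl).
apply continuousC_pair; simpl; [apply continuous_const|apply continuous_id].
Qed.

(** The common side is run through in both directions and cancels. *)
Lemma rect_int_split_x (h : C -> C) (a b c d p : R) :
  holo_rect h a b c d -> (a <= p <= b)%R -> (c <= d)%R ->
  rect_int h a b c d = rect_int h a p c d + rect_int h p b c d.
Proof.
intros H Hp Hcd; unfold rect_int.
rewrite <- (RInt_Chasles (V := C_R_CompleteNormedModule) (fun x => h (x, c)) a p b),
        <- (RInt_Chasles (V := C_R_CompleteNormedModule) (fun x => h (x, d)) a p b);
  try (apply (ex_RIntC_hor h a b c d); [assumption|lra..]).
change plus with Cplus; ring.
Qed.

Lemma rect_int_split_y (h : C -> C) (a b c d p : R) :
  holo_rect h a b c d -> (c <= p <= d)%R -> (a <= b)%R ->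
  rect_int h a b c d = rect_int h a b c p + rect_int h a b p d.
Proof.
intros H Hp Hcd; unfold rect_int.
rewrite <- (RInt_Chasles (V := C_R_CompleteNormedModule) (fun y => h (a, y)) c p d),
        <- (RInt_Chasles (V := C_R_CompleteNormedModule) (fun y => h (b, y)) c p d);
  try (apply (ex_RIntC_vert h a b c d); [assumption|lra..]).
change plus with Cplus; ring.
Qed.

(** An affine function has a primitive, so only the remainder of [h]
    contributes to its boundary integral. *)
Lemma rect_int_affine_bound (h : C -> C) (a b c d e : R) (z0 l : C) :
  holo_rect h a b c d -> (a <= b)%R -> (c <= d)%R ->
  (forall x y : R, (a <= x <= b)%R -> (c <= y <= d)%R ->
     (Cmod (h (x, y) - h z0 - l * ((x, y) - z0)) <= e)%R) ->
  (Cmod (rect_int h a b c d) <= 2 * e * ((b - a) + (d - c)))%R.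
Proof.
intros H Hab Hcd He.
set (u := h z0) in *.
(* A complex primitive of the affine part u + l (z - z0). *)
set (Q := fun z : C => u * z + / 2 * (l * ((z - z0) * (z - z0)))).
assert (Csub_add : forall p q : C, p = p - q + q) by (intros; ring).
assert (H2 : / 2 = RtoC (/ 2)) by (rewrite RtoC_inv by lra; reflexivity).
assert (hor : forall y, (c <= y <= d)%R -> exists r : C,
  RIntC (fun x => h (x, y)) a b = r + (Q (b, y) - Q (a, y)) :> C /\ (Cmod r <= (b - a) * e)%R).
{ intros y Hy.
  assert (Hq : is_RIntC (fun x => u + l * ((x, y) - z0)) a b (Q (b, y) - Q (a, y))).
  { apply (is_RIntC_Cderive (fun x => Q (x, y))).
    - intros x; unfold Q; rewrite H2; destruct u, l, z0; simpl; auto_derive; [exact I|field].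
    - intros x; unfold Q; rewrite H2; destruct u, l, z0; simpl; auto_derive; [exact I|field].
    - intros x; apply continuousC_pair; destruct u, l, z0; simpl;
        apply (ex_derive_continuous (V := R_NormedModule)); auto_derive; exact I. }
  pose proof (RInt_correct _ _ _
    (ex_RIntC_hor h a b c d a b y H (Rle_refl a) Hab (Rle_refl b) Hy)) as Hh.
  pose proof (is_RInt_minus _ _ _ _ _ _ Hh Hq) as Hr.
  refine (ex_intro _ _ (conj _ (is_RIntC_bound _ a b e _ Hab _ Hr))).
  - apply Csub_add.
  - intros x Hx; change minus with Cminus.
    replace (h (x, y) - (u + l * ((x, y) - z0))) with
      (h (x, y) - u - l * ((x, y) - z0)) by ring.
    now apply He. }
(* Along a vertical side the y-derivative of [Q] is i times the affine part, so the primitive in y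
   is -i [Q]. *)
assert (vert : forall x, (a <= x <= b)%R -> exists r : C,
  RIntC (fun y => h (x, y)) c d = r + (- Ci * Q (x, d) - - Ci * Q (x, c)) :> C /\
  (Cmod r <= (d - c) * e)%R).
{ intros x Hx.
  assert (Hq : is_RIntC (fun y => u + l * ((x, y) - z0)) c d
     (- Ci * Q (x, d) - - Ci * Q (x, c))).
  { apply (is_RIntC_Cderive (fun y => - Ci * Q (x, y))).
    - intros y; unfold Q; rewrite H2; destruct u, l, z0; simpl; auto_derive; [exact I|field].
    - intros y; unfold Q; rewrite H2; destruct u, l, z0; simpl; auto_derive; [exact I|field].
    - intros y; apply continuousC_pair; destruct u, l, z0; simpl;
        apply (ex_derive_continuous (V := R_NormedModule)); auto_derive; exact I. }
  pose proof (RInt_correct _ _ _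
    (ex_RIntC_vert h a b c d c d x H (Rle_refl c) Hcd (Rle_refl d) Hx)) as Hh.
  pose proof (is_RInt_minus _ _ _ _ _ _ Hh Hq) as Hr.
  refine (ex_intro _ _ (conj _ (is_RIntC_bound _ c d e _ Hcd _ Hr))).
  - apply Csub_add.
  - intros y Hy; change minus with Cminus.
    replace (h (x, y) - (u + l * ((x, y) - z0))) with
      (h (x, y) - u - l * ((x, y) - z0)) by ring.
    now apply He. }
destruct (hor c) as [r1 [E1 B1]]; [lra|]; destruct (hor d) as [r2 [E2 B2]]; [lra|].
destruct (vert b) as [r3 [E3 B3]]; [lra|]; destruct (vert a) as [r4 [E4 B4]]; [lra|].
unfold rect_int; rewrite E1, E2, E3, E4.
(* The corner values of [Q] carry the common factor 1 + i^2 = 0, so only the remainders of the four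
   sides are left. *)
assert (HCi : Ci * Ci = - 1) by (unfold Ci, Cmult, Copp, RtoC; simpl; f_equal; ring).
match goal with |- (Cmod ?X <= _)%R => replace X with
  (r1 + - r2 + Ci * (r3 + - r4) + (1 + Ci * Ci) *
     (Q (a, d) - Q (b, d) + Q (b, c) - Q (a, c))) by ring end.
rewrite HCi.
match goal with |- (Cmod ?X <= _)%R => replace X with
  (r1 + - r2 + Ci * (r3 + - r4)) by ring end.
pose proof (Cmod_triangle (r1 + - r2) (Ci * (r3 + - r4))) as T1.
pose proof (Cmod_triangle r1 (- r2)) as T2.
pose proof (Cmod_triangle r3 (- r4)) as T3.
rewrite Cmod_mult, Cmod_Ci in T1; rewrite Cmod_opp in T2, T3; lra.
Qed.

Lemma nested_intervals (u v : nat -> R) :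
  (forall n, (u n <= u (S n))%R) -> (forall n, (v (S n) <= v n)%R) ->
  (forall n, (u n <= v n)%R) -> exists x, forall n, (u n <= x <= v n)%R.
Proof.
intros Hu Hv Huv.
assert (Mu : forall n k, (u n <= u (n + k)%nat)%R).
{ intros n k; induction k as [|k IH]; [rewrite Nat.add_0_r; apply Rle_refl|].
  rewrite Nat.add_succ_r; eapply Rle_trans; [exact IH|apply Hu]. }
assert (Mv : forall n k, (v (n + k)%nat <= v n)%R).
{ intros n k; induction k as [|k IH]; [rewrite Nat.add_0_r; apply Rle_refl|].
  rewrite Nat.add_succ_r; eapply Rle_trans; [apply Hv|exact IH]. }
assert (U : forall n k, (u n <= v k)%R).
{ intros n k; eapply Rle_trans; [apply (Mu n k)|].
  eapply Rle_trans; [apply Huv|]; rewrite Nat.add_comm; apply Mv. }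
destruct (completeness (fun x => exists n, x = u n)) as [x [Hx1 Hx2]].
- exists (v 0%nat); intros r [n ->]; apply U.
- now exists (u 0%nat), 0%nat.
- exists x; intros n; split; [apply Hx1; now exists n|].
  apply Hx2; intros r [k ->]; apply U.
Qed.

Record rect := Rect { xl : R; xr : R; yl : R; yr : R }.

Definition good_rect (h : C -> C) (r : rect) : Prop :=
  (xl r <= xr r)%R /\ (yl r <= yr r)%R /\ holo_rect h (xl r) (xr r) (yl r) (yr r).

Definition rect_bdry (h : C -> C) (r : rect) : C :=
  rect_int h (xl r) (xr r) (yl r) (yr r).

Definition quarter_of (h : C -> C) (r r' : rect) : Prop :=
  good_rect h r' /\
  (xl r <= xl r')%R /\ (xr r' <= xr r)%R /\ (yl r <= yl r')%R /\ (yr r' <= yr r)%R /\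
  (xr r' - xl r' = (xr r - xl r) / 2)%R /\ (yr r' - yl r' = (yr r - yl r) / 2)%R /\
  (Cmod (rect_bdry h r) <= 4 * Cmod (rect_bdry h r'))%R.

(** Halving in x and then in y costs a factor 2 each time: if one half carries less than half of the
    integral, the triangle inequality gives the other half at least that much. The result is a sigma
    type, obtained by deciding real inequalities, so that it can be iterated without choice. *)
Lemma quarter_rect (h : C -> C) (r : rect) :
  good_rect h r -> { r' : rect | quarter_of h r r' }.
Proof.
destruct r as [a b c d]; unfold good_rect; simpl; intros [Hab [Hcd H]].
assert (Hx : {ab : R * R | (a <= fst ab)%R /\ (fst ab <= snd ab)%R /\ (snd ab <= b)%R /\
   (snd ab - fst ab = (b - a) / 2)%R /\
   (Cmod (rect_int h a b c d) <= 2 * Cmod (rect_int h (fst ab) (snd ab) c d))%R}).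
{ set (p := ((a + b) / 2)%R).
  assert (Hp : (a <= p <= b)%R) by (unfold p; lra).
  pose proof (rect_int_split_x h a b c d p H Hp Hcd) as E.
  pose proof (Cmod_triangle (rect_int h a p c d) (rect_int h p b c d)) as T.
  rewrite <- E in T.
  destruct (Rle_dec (Cmod (rect_int h a b c d)) (2 * Cmod (rect_int h a p c d))) as [G|G].
  - exists (a, p); simpl; repeat split; try lra; unfold p; lra.
  - exists (p, b); simpl; repeat split; try lra; unfold p; lra. }
destruct Hx as [[a' b'] [Ha [Hab' [Hb [Lx Jx]]]]]; simpl in *.
assert (H' : holo_rect h a' b' c d) by (intros x y Hx Hy; apply H; lra).
assert (Hy : {cd : R * R | (c <= fst cd)%R /\ (fst cd <= snd cd)%R /\ (snd cd <= d)%R /\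
   (snd cd - fst cd = (d - c) / 2)%R /\
   (Cmod (rect_int h a' b' c d) <= 2 * Cmod (rect_int h a' b' (fst cd) (snd cd)))%R}).
{ set (p := ((c + d) / 2)%R).
  assert (Hp : (c <= p <= d)%R) by (unfold p; lra).
  pose proof (rect_int_split_y h a' b' c d p H' Hp Hab') as E.
  pose proof (Cmod_triangle (rect_int h a' b' c p) (rect_int h a' b' p d)) as T.
  rewrite <- E in T.
  destruct (Rle_dec (Cmod (rect_int h a' b' c d)) (2 * Cmod (rect_int h a' b' c p))) as [G|G].
  - exists (c, p); simpl; repeat split; try lra; unfold p; lra.
  - exists (p, d); simpl; repeat split; try lra; unfold p; lra. }
destruct Hy as [[c' d'] [Hc [Hcd' [Hd [Ly Jy]]]]]; simpl in *.
exists (Rect a' b' c' d'); unfold quarter_of, good_rect, rect_bdry; simpl.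
repeat split; try lra.
intros x y Hx Hy; apply H; lra.
Qed.

(** The proof of [good_rect] travels with each rectangle because the next bisection needs it as
    input. *)
Fixpoint quarter_seq (h : C -> C) (r0 : {r : rect | good_rect h r}) (n : nat) :
  {r : rect | good_rect h r} :=
  match n with
  | O => r0
  | S k =>
    let r := quarter_seq h r0 k in
    let q := quarter_rect h (proj1_sig r) (proj2_sig r) in
    exist _ (proj1_sig q) (proj1 (proj2_sig q))
  end.

(** On the n-th quarter, of half-perimeter L / 2^n, the remainder at the limit point is at most e' L
    / 2^n, so the boundary integral is at most 2 e' (L / 2^n)^2. This gain of 4^(-n) exactly offsets
    the loss 4^n of the bisection, leaving 2 e' L^2 with e' arbitrary. *)
Lemma goursat_rect (h : C -> C) (a b c d : R) :
  (a <= b)%R -> (c <= d)%R -> holo_rect h a b c d -> rect_int h a b c d = 0.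
Proof.
intros Hab Hcd H.
assert (G : good_rect h (Rect a b c d)) by (repeat split; assumption).
set (s := fun n => proj1_sig (quarter_seq h (exist _ (Rect a b c d) G) n)).
assert (Hq : forall n, quarter_of h (s n) (s (S n))).
{ intros n; unfold s; simpl; apply (proj2_sig (quarter_rect _ _ _)). }
assert (Hg : forall n, good_rect h (s n)).
{ intros n; apply (proj2_sig (quarter_seq _ _ n)). }
assert (H0 : s 0%nat = Rect a b c d) by reflexivity.
clearbody s.
set (L := ((b - a) + (d - c))%R).
assert (Hlen : forall n, (xr (s n) - xl (s n) + (yr (s n) - yl (s n)) = L * (/ 2) ^ n)%R).
{ induction n as [|n IH]; [rewrite H0; unfold L; simpl; ring|].
  destruct (Hq n) as (_ & _ & _ & _ & _ & Lx & Ly & _).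
  simpl; rewrite Lx, Ly; lra. }
assert (HJ : forall n, (Cmod (rect_int h a b c d) <= 4 ^ n * Cmod (rect_bdry h (s n)))%R).
{ induction n as [|n IH]; [rewrite H0; unfold rect_bdry; simpl; lra|].
  destruct (Hq n) as (_ & _ & _ & _ & _ & _ & _ & HJ).
  simpl; pose proof (pow_lt 4 n ltac:(lra)); nra. }
destruct (nested_intervals (fun n => xl (s n)) (fun n => xr (s n))) as [x Hx];
  try (intros n; first [apply (Hq n) | apply (Hg n)]).
destruct (nested_intervals (fun n => yl (s n)) (fun n => yr (s n))) as [y Hy];
  try (intros n; first [apply (Hq n) | apply (Hg n)]).
destruct (H x y) as [l Hl].
{ specialize (Hx 0%nat); rewrite H0 in Hx; exact Hx. }
{ specialize (Hy 0%nat); rewrite H0 in Hy; exact Hy. }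
assert (HL : (0 <= L)%R) by (unfold L; lra).
apply Cmod_eq_0.
apply Rle_antisym; [|apply Cmod_ge_0].
apply le_epsilon; intros e He; rewrite Rplus_0_l.
(* The summand 1, like the one in [L + 1] below, covers a rectangle reduced to a point, where L =
   0. *)
set (e' := (e / (2 * L * L + 1))%R).
assert (He' : (0 < e')%R) by (apply Rdiv_lt_0_compat; nra).
assert (Hee : (2 * e' * L * L <= e)%R).
{ assert (E : (e = e' * (2 * L * L + 1))%R) by (unfold e'; field; nra).
  clearbody e'; lra. }
destruct (is_deriveC_eps _ _ _ Hl e' He') as [dl [Hdl Hd]].
destruct (pow_lt_1_zero (/ 2) ltac:(rewrite Rabs_pos_eq; lra) (dl / (L + 1))) as [n Hn].
{ apply Rdiv_lt_0_compat; lra. }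
specialize (Hn n (le_n n)).
assert (Hp : (0 < (/ 2) ^ n)%R) by (apply pow_lt; lra).
rewrite Rabs_pos_eq in Hn by lra.
set (Ln := (L * (/ 2) ^ n)%R) in *.
assert (HLn : (Ln < dl)%R).
{ apply (Rmult_lt_compat_r (L + 1)) in Hn; [|lra].
  replace (dl / (L + 1) * (L + 1))%R with dl in Hn by (field; lra).
  unfold Ln; nra. }
specialize (Hlen n); specialize (Hx n); specialize (Hy n).
destruct (Hg n) as (Gx & Gy & Gh).
assert (B : (Cmod (rect_bdry h (s n)) <= 2 * (e' * Ln) * Ln)%R).
{ fold Ln in Hlen; rewrite <- Hlen at 2.
  apply (rect_int_affine_bound _ _ _ _ _ _ (x, y) l); try assumption.
  intros x' y' Hx' Hy'.
  assert (M : (Cmod ((x', y') - (x, y)) <= Ln)%R).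
  { eapply Rle_trans; [apply Cmod_le_Rabs|]; simpl.
    assert (Rabs (x' + - x) <= xr (s n) - xl (s n))%R by (apply Rabs_le; lra).
    assert (Rabs (y' + - y) <= yr (s n) - yl (s n))%R by (apply Rabs_le; lra).
    lra. }
  eapply Rle_trans; [apply Hd; lra|].
  apply Rmult_le_compat_l; lra. }
specialize (HJ n).
assert (P4 : (4 ^ n * ((/ 2) ^ n * (/ 2) ^ n) = 1)%R).
{ rewrite <- !Rpow_mult_distr; replace (4 * (/ 2 * / 2))%R with 1%R by lra; apply pow1. }
assert (P4p : (0 < 4 ^ n)%R) by (apply pow_lt; lra).
eapply Rle_trans; [exact HJ|].
eapply Rle_trans; [apply Rmult_le_compat_l; [lra|exact B]|].
unfold Ln.
replace (4 ^ n * (2 * (e' * (L * (/ 2) ^ n)) * (L * (/ 2) ^ n)))%R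
  with (2 * e' * L * L * (4 ^ n * ((/ 2) ^ n * (/ 2) ^ n)))%R by ring.
rewrite P4; lra.
Qed.

(** * Moving the contour to the unit circle *)

Definition cexp (z : C) : C := RtoC (exp (fst z)) * expi (snd z).

Lemma cexp_plus (z w : C) : cexp (z + w) = cexp z * cexp w.
Proof.
unfold cexp; simpl; rewrite exp_plus, expi_plus, RtoC_mult; ring.
Qed.

Lemma sin_mean_value (t : R) :
  exists c : R, (Rabs c <= Rabs t)%R /\ sin t = (t * cos c)%R.
Proof.
destruct (MVT_gen sin 0 t cos) as [c [Hc E]].
- intros x _; auto_derive; [exact I|ring].
- intros x _; apply continuity_sin.
- exists c; split; [|rewrite sin_0 in E; lra].
  unfold Rmin, Rmax in Hc; destruct (Rle_dec 0 t).
  + rewrite !Rabs_pos_eq; lra.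
  + rewrite !Rabs_left1; lra.
Qed.

(** 1 - cos t = 2 sin^2 (t / 2), and |sin (t / 2)| <= |t / 2| by the mean value theorem. *)
Lemma one_minus_cos_bound (t : R) : (0 <= 1 - cos t <= t ^ 2 / 2)%R.
Proof.
replace t with (2 * (t / 2))%R at 1 2 by field.
rewrite cos_2a_sin.
destruct (sin_mean_value (t / 2)) as [c [_ ->]].
pose proof (COS_bound c); split; [nra|].
assert (0 <= 1 - cos c * cos c)%R by nra.
pose proof (pow2_ge_0 t); nra.
Qed.

Lemma sin_minus_id_bound (t : R) : (Rabs (sin t - t) <= Rabs t * t ^ 2)%R.
Proof.
destruct (sin_mean_value t) as [c [Hc ->]].
replace (t * cos c - t)%R with (t * - (1 - cos c))%R by ring.
rewrite Rabs_mult, Rabs_Ropp; apply Rmult_le_compat_l; [apply Rabs_pos|].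
pose proof (one_minus_cos_bound c); rewrite Rabs_pos_eq by lra.
rewrite <- (pow2_abs c) in H; rewrite <- (pow2_abs t).
pose proof (Rabs_pos c); nra.
Qed.

(** The inequality 1 + y <= exp y at y = -x gives exp x (1 - x) <= 1, while (1 + x + 2 x^2) (1 - x)
    = 1 + x^2 (1 - 2 x) >= 1 as long as x <= 1/2. *)
Lemma exp_taylor1_bound (x : R) : (Rabs x <= / 2)%R ->
  (0 <= exp x - 1 - x <= 2 * x ^ 2)%R.
Proof.
intros Hx; apply Rabs_le_between in Hx.
pose proof (exp_ineq1_le x) as H1; pose proof (exp_ineq1_le (- x)) as H2.
pose proof (exp_pos x) as H3.
assert (E : (exp x * exp (- x) = 1)%R) by (rewrite <- exp_plus, Rplus_opp_r; apply exp_0).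
split; [lra|].
assert (exp x * (1 - x) <= 1)%R by nra.
nra.
Qed.

(** The constant 6 is 3 for each component, using exp x <= 2. The real part is (exp x - 1 - x) - exp
    x (1 - cos y), the imaginary part exp x (sin y - y) + y (exp x - 1); the cubic term of the
    latter is absorbed because |y| <= 1/2. *)
Lemma cexp_taylor1_bound (u : C) : (Cmod u <= / 2)%R ->
  (Cmod (cexp u - 1 - u) <= 6 * Cmod u ^ 2)%R.
Proof.
intros Hu; pose proof (Rmax_Cmod u) as Hm.
pose proof (Rmax_l (Rabs (fst u)) (Rabs (snd u))).
pose proof (Rmax_r (Rabs (fst u)) (Rabs (snd u))).
set (r := Cmod u) in *; destruct u as [x y]; simpl in *.
assert (Hx : (Rabs x <= r)%R) by lra; assert (Hy : (Rabs y <= r)%R) by lra.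
pose proof (Rabs_pos x) as Px; pose proof (Rabs_pos y) as Py.
clearbody r.
unfold cexp, expi, Cmult, Cminus, Cplus, Copp, RtoC; simpl.
eapply Rle_trans; [apply Cmod_le_Rabs|].
pose proof (exp_taylor1_bound x ltac:(lra)) as He.
pose proof (one_minus_cos_bound y) as Hc.
pose proof (sin_minus_id_bound y) as Hs.
rewrite <- (pow2_abs x) in He; rewrite <- (pow2_abs y) in Hc, Hs.
assert (E2 : (0 < exp x <= 2)%R).
{ split; [apply exp_pos|]; pose proof (Rle_abs x); nra. }
assert (B1 : (Rabs (exp x - 1) <= 2 * Rabs x)%R).
{ replace (exp x - 1)%R with (x + (exp x - 1 - x))%R by ring.
  eapply Rle_trans; [apply Rabs_triang|]; rewrite (Rabs_pos_eq (exp x - 1 - x)) by lra; nra. }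
assert (P1 : (Rabs (exp x * cos y - 0 * sin y + - (1) + - x) <= 3 * r ^ 2)%R).
{ replace (exp x * cos y - 0 * sin y + - (1) + - x)%R with
    ((exp x - 1 - x) + - (exp x * (1 - cos y)))%R by ring.
  eapply Rle_trans; [apply Rabs_triang|].
  rewrite Rabs_Ropp, Rabs_mult, !Rabs_pos_eq by lra.
  assert (exp x * (1 - cos y) <= 2 * (Rabs y ^ 2 / 2))%R by (apply Rmult_le_compat; lra).
  nra. }
assert (P2 : (Rabs (exp x * sin y + 0 * cos y + - 0 + - y) <= 3 * r ^ 2)%R).
{ replace (exp x * sin y + 0 * cos y + - 0 + - y)%R with
    (exp x * (sin y - y) + y * (exp x - 1))%R by ring.
  eapply Rle_trans; [apply Rabs_triang|].
  rewrite !Rabs_mult, (Rabs_pos_eq (exp x)) by lra.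
  assert (exp x * Rabs (sin y - y) <= 2 * (Rabs y * Rabs y ^ 2))%R
    by (apply Rmult_le_compat; try apply Rabs_pos; lra).
  assert (Rabs y * Rabs (exp x - 1) <= Rabs y * (2 * Rabs x))%R
    by (apply Rmult_le_compat_l; lra).
  nra. }
simpl in P1, P2; lra.
Qed.

(** The functional equation factors [cexp z] out of the increment and leaves the quadratic estimate
    at 0. *)
Lemma is_derive_cexp (z : C) : is_deriveC cexp z (cexp z).
Proof.
apply is_deriveC_of_eps; intros eps Heps.
set (M := (6 * Cmod (cexp z) + 1)%R).
assert (HM : (1 <= M)%R) by (unfold M; pose proof (Cmod_ge_0 (cexp z)); lra).
exists (Rmin (/ 2) (eps / M)); split.
{ apply Rmin_pos; [lra|]; apply Rdiv_lt_0_compat; lra. }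
intros w Hw.
pose proof (Rmin_l (/ 2) (eps / M)); pose proof (Rmin_r (/ 2) (eps / M)).
replace (cexp w) with (cexp z * cexp (w - z)) by (rewrite <- cexp_plus; f_equal; ring).
set (u := w - z) in *.
replace (cexp z * cexp u - cexp z - cexp z * u) with (cexp z * (cexp u - 1 - u)) by ring.
rewrite Cmod_mult.
pose proof (cexp_taylor1_bound u ltac:(lra)) as B.
pose proof (Cmod_ge_0 u); pose proof (Cmod_ge_0 (cexp z)).
assert (HuM : (M * Cmod u <= eps)%R).
{ replace eps with (M * (eps / M))%R by (field; lra).
  apply Rmult_le_compat_l; lra. }
unfold M in HuM.
apply Rle_trans with (Cmod (cexp z) * (6 * Cmod u ^ 2))%R.
- apply Rmult_le_compat_l; lra.
- nra.
Qed.

(** Passage from the module structure used in [analytic_at] to that of [is_deriveC]; both unfold to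
    the same epsilon-delta condition. *)
Lemma Cdiff_of_analytic (f : C -> C) (z : C) :
  analytic_at f z -> Cdiff_at f z.
Proof.
intros H; apply locally_singleton in H; destruct H as [l [_ H]]; exists l.
apply is_deriveC_of_eps; intros eps Heps.
destruct (H z (fun P HP => HP) (mkposreal eps Heps)) as [d Hd].
exists d; split; [apply cond_pos|].
intros w Hw; specialize (Hd w Hw); rewrite (Cmult_comm l); exact Hd.
Qed.

(** Confocal ellipses are nested: the sum of focal distances on the ellipse of parameter r is r +
    1/r, which increases for r >= 1 by the factorisation [E]. *)
Lemma bernstein_point_region (rho r t : R) :
  (1 <= r <= rho)%R -> (0 <= t <= 2 * PI)%R ->
  bernstein_region rho (bernstein_point r t).
Proof.
intros Hr Ht; unfold bernstein_region.
rewrite (proj1 (bernstein_ellipse_foci r _ (proj1 Hr))) by now exists t.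
assert (E : (rho + / rho - (r + / r) = (rho - r) * (1 - / r * / rho))%R) by (field; lra).
assert (B1 : (0 < / r <= 1)%R).
{ split; [apply Rinv_0_lt_compat; lra|]; rewrite <- Rinv_1; apply Rinv_le_contravar; lra. }
assert (B2 : (0 < / rho <= 1)%R).
{ split; [apply Rinv_0_lt_compat; lra|]; rewrite <- Rinv_1; apply Rinv_le_contravar; lra. }
assert (/ r * / rho <= 1)%R by nra.
assert (0 <= (rho - r) * (1 - / r * / rho))%R by (apply Rmult_le_pos; lra).
lra.
Qed.

Lemma bernstein_point_cexp (x y : R) :
  bernstein_point (exp x) y = / 2 * (cexp (x, y) + cexp (- (x, y))).
Proof. unfold bernstein_point, cexp; simpl; now rewrite exp_Ropp. Qed.

(** In the coordinates [w = x + i y], [z = (e^w + e^(-w)) / 2]. *)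
Definition shift_integrand (g : C -> C) (n : nat) (w : C) : C :=
  g (/ 2 * (cexp w + cexp (- w))) * cexp (- RtoC (INR n) * w).

(** On the line Re w = x the factor e^(-n w) has modulus (e^x)^(-n); this is the origin of the
    weight [/ rho ^ n]. *)
Lemma shift_integrand_E (g : C -> C) (n : nat) (x y : R) :
  shift_integrand g n (x, y) =
  RtoC (/ exp x ^ n) * (g (bernstein_point (exp x) y) * expi (- (INR n * y))).
Proof.
unfold shift_integrand; rewrite <- bernstein_point_cexp.
assert (E : exp (INR n * x) = (exp x ^ n)%R).
{ induction n as [|n IH]; [now rewrite Rmult_0_l, exp_0|].
  rewrite S_INR; replace ((INR n + 1) * x)%R with (x + INR n * x)%R by ring.
  now rewrite exp_plus, IH. }
rewrite <- E, <- exp_Ropp.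
replace (- RtoC (INR n) * (x, y)) with ((- (INR n * x))%R, (- (INR n * y))%R).
- unfold cexp; cbn [fst snd]; ring.
- unfold Cmult, Copp, RtoC; simpl; f_equal; ring.
Qed.

Lemma shift_integrand_holo (rho : R) (g : C -> C) (n : nat) :
  (1 <= rho)%R ->
  (forall z, bernstein_region rho z -> Cdiff_at g z) ->
  holo_rect (shift_integrand g n) 0 (ln rho) 0 (2 * PI).
Proof.
intros Hrho Hg x y Hx Hy; unfold shift_integrand.
assert (Hr : (1 <= exp x <= rho)%R).
{ split; [pose proof (exp_ineq1_le x); lra|].
  rewrite <- (exp_ln rho) by lra.
  destruct (proj2 Hx) as [L|L]; [left; now apply exp_increasing|rewrite L; lra]. }
assert (Hexp : forall c w, Cdiff_at (fun w => cexp (c * w)) w).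
{ intros c w; apply (Cdiff_comp cexp); [eexists; apply is_derive_cexp|].
  apply Cdiff_scal, Cdiff_id. }
apply Cdiff_mult; [|apply Hexp].
apply (Cdiff_comp g).
- rewrite <- bernstein_point_cexp; apply Hg, bernstein_point_region; assumption.
- apply Cdiff_scal, Cdiff_plus; [eexists; apply is_derive_cexp|].
  apply (Cdiff_ext (fun w => cexp (- (1) * w))); [|apply Hexp].
  intros w; f_equal; ring.
Qed.

Lemma bernstein_integrand_continuous (rho r : R) (g : C -> C) (n : nat) (t : R) :
  (1 <= r <= rho)%R ->
  (forall z, bernstein_region rho z -> Cdiff_at g z) ->
  (0 <= t <= 2 * PI)%R ->
  continuousC (fun t => g (bernstein_point r t) * expi (- (INR n * t))) t.
Proof.
intros Hr Hg Ht; apply continuousC_mult.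
- destruct (Hg (bernstein_point r t)) as [l Hl]; [now apply bernstein_point_region|].
  apply (continuousC_comp_deriveC g _ t l Hl).
  apply continuousC_pair; unfold bernstein_point, expi; simpl;
    apply (ex_derive_continuous (V := R_NormedModule)); auto_derive; exact I.
- apply (continuous_ext (fun t => expi (- INR n * t))).
  + intros x; f_equal; ring.
  + apply continuousC_expi.
Qed.

(** The horizontal sides of the rectangle cancel because the integrand has
    period 2 pi i. *)
Lemma contour_shift (rho : R) (g : C -> C) (n : nat) :
  (1 <= rho)%R ->
  (forall z, bernstein_region rho z -> Cdiff_at g z) ->
  RIntC (fun t => g (bernstein_point 1 t) * expi (- (INR n * t))) 0 (2 * PI) =
  RtoC (/ rho ^ n) *
  RIntC (fun t => g (bernstein_point rho t) * expi (- (INR n * t))) 0 (2 * PI) :> C.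
Proof.
intros Hrho Hg; assert (HPI := PI_RGT_0).
assert (Hln : (0 <= ln rho)%R).
{ rewrite <- ln_1; destruct Hrho as [L|L]; [left; apply ln_increasing; lra|rewrite L; lra]. }
pose proof (shift_integrand_holo rho g n Hrho Hg) as Hh.
pose proof (goursat_rect (shift_integrand g n) 0 (ln rho) 0 (2 * PI) Hln ltac:(lra) Hh) as G.
unfold rect_int in G.
rewrite (RInt_ext (V := C_R_CompleteNormedModule)
  (fun x => shift_integrand g n (x, 2 * PI)%R) (fun x => shift_integrand g n (x, 0%R))) in G.
2:{ intros x _; rewrite !shift_integrand_E; f_equal; f_equal.
  - f_equal; unfold bernstein_point, expi.
    now rewrite !cos_neg, !sin_neg, cos_2PI, sin_2PI, cos_0, sin_0.
  - rewrite Rmult_0_r, Ropp_0, expi_0.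
    rewrite <- (expi_2PI_Z (- Z.of_nat n)), opp_IZR, <- INR_IZR_INZ; f_equal; ring. }
assert (Ci <> 0) as HCi by (intros K; apply (f_equal snd) in K; simpl in K; lra).
assert (E : RIntC (fun y => shift_integrand g n (0%R, y)) 0 (2 * PI) =
  RIntC (fun y => shift_integrand g n (ln rho, y)) 0 (2 * PI) :> C).
{ set (I0 := RIntC (fun y => shift_integrand g n (0%R, y)) 0 (2 * PI) : C) in *.
  set (I1 := RIntC (fun y => shift_integrand g n (ln rho, y)) 0 (2 * PI) : C) in *.
  match type of G with ?u - ?u + _ = _ => set (J := u : C) in * end.
  replace I1 with (I0 + / Ci * (J - J + Ci * (I1 - I0))) by (field; assumption).
  rewrite G; ring. }
rewrite (RInt_ext (V := C_R_CompleteNormedModule) (fun y => shift_integrand g n (0%R, y))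
   (fun t => g (bernstein_point 1 t) * expi (- (INR n * t)))) in E.
2:{ intros y _; rewrite shift_integrand_E, exp_0, pow1, Rinv_1; apply Cmult_1_l. }
rewrite E; clear E.
rewrite (RInt_ext (V := C_R_CompleteNormedModule) (fun y => shift_integrand g n (ln rho, y))
   (fun t => RtoC (/ rho ^ n) * (g (bernstein_point rho t) * expi (- (INR n * t))))).
2:{ intros y _; rewrite shift_integrand_E, exp_ln by lra; reflexivity. }
apply (is_RInt_unique (V := C_R_CompleteNormedModule)), is_RIntC_Cmult,
  (RInt_correct (V := C_R_CompleteNormedModule)).
apply ex_RInt_continuous; intros t Ht.
rewrite Rmin_left, Rmax_right in Ht by lra.
apply bernstein_integrand_continuous with rho; try assumption; lra.
Qed.

(** * Chebyshev coefficients as integrals over the circle *)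

(** Since cos decreases on [0, PI], d = 1 - cos e' works; capping e' at PI / 2 keeps cos e' >= 0 and
    hence b > -1. *)
Lemma acos_near_1 (e : R) : (0 < e)%R -> exists d : R, (0 < d)%R /\
  forall b : R, (1 - d < b < 1)%R -> (-1 < b)%R /\ (0 < acos b < e)%R.
Proof.
intros He; pose proof PI_RGT_0 as HPI.
set (e' := Rmin e (PI / 2)).
assert (He' : (0 < e' <= PI / 2)%R).
{ split; [apply Rmin_pos; lra|apply Rmin_r]. }
assert (Hee : (e' <= e)%R) by apply Rmin_l.
assert (Hc : (0 <= cos e' < 1)%R).
{ split; [apply cos_ge_0; lra|]; rewrite <- cos_0; apply cos_decreasing_1; lra. }
exists (1 - cos e')%R; split; [lra|]; intros b Hb; split; [lra|].
pose proof (acos_bound_lt b ltac:(lra)) as Ha; split; [lra|].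
apply Rnot_le_lt; intros L.
assert (K : (cos (acos b) <= cos e')%R) by (apply cos_decr_1; lra).
rewrite cos_acos in K; lra.
Qed.

Lemma is_derive_acos (x : R) : (-1 < x < 1)%R ->
  is_derive acos x (-1 / sqrt (1 - x ^ 2))%R.
Proof.
intros Hx; apply is_derive_Reals.
replace (x ^ 2)%R with (Rsqr x) by (unfold Rsqr; ring).
rewrite <- (derive_pt_acos x Hx).
apply derive_pt_eq_1 with (derivable_pt_acos x Hx); reflexivity.
Qed.

(** Inside (-1,1) the weight is minus the derivative of [acos]; that sign is absorbed by exchanging
    the bounds, as [acos] is decreasing. *)
Lemma is_RInt_acos_subst (phi : R -> C) (a b : R) :
  (-1 < a < 1)%R -> (-1 < b < 1)%R -> (forall t, continuousC phi t) ->
  is_RIntC (fun x => phi (acos x) / RtoC (sqrt (1 - x ^ 2))) a b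
    (RIntC phi (acos b) (acos a)).
Proof.
intros Ha Hb Hphi.
assert (Hin : forall x, (Rmin b a <= x <= Rmax b a)%R -> (-1 < x < 1)%R).
{ intros x Hx; unfold Rmin, Rmax in Hx; destruct (Rle_dec b a); lra. }
assert (H := is_RInt_comp (V := C_R_CompleteNormedModule) phi acos
  (fun x => -1 / sqrt (1 - x ^ 2))%R b a).
specialize (H ltac:(intros; apply Hphi)).
assert (H1 : forall x : R, (Rmin b a <= x <= Rmax b a)%R -> (0 < 1 - x ^ 2)%R).
{ intros x Hx; apply Hin in Hx; nra. }
assert (H2 : forall x : R, (Rmin b a <= x <= Rmax b a)%R ->
  is_derive acos x (-1 / sqrt (1 - x ^ 2))%R /\
  continuous (fun x => -1 / sqrt (1 - x ^ 2))%R x).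
{ intros x Hx; split; [now apply is_derive_acos, Hin|].
  specialize (H1 x Hx); pose proof (sqrt_lt_R0 _ H1).
  apply (ex_derive_continuous (V := R_NormedModule)); auto_derive.
  replace (1 + - (x * (x * 1)))%R with (1 - x ^ 2)%R by ring; repeat split; lra. }
specialize (H H2).
apply is_RInt_swap, is_RInt_opp in H; rewrite opp_opp in H.
refine (is_RInt_ext _ _ _ _ _ _ H).
intros x Hx; rewrite Rmin_comm, Rmax_comm in Hx.
specialize (H1 x ltac:(lra)); pose proof (sqrt_lt_R0 _ H1).
rewrite scal_R_Cmult; change opp with Copp.
generalize (phi (acos x)); intros c.
unfold Cdiv; rewrite <- RtoC_inv by lra.
replace (-1 / sqrt (1 - x ^ 2))%R with (- / sqrt (1 - x ^ 2))%R by (field; lra).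
rewrite RtoC_opp.
change (- (- RtoC (/ sqrt (1 - x ^ 2)) * c) = c * RtoC (/ sqrt (1 - x ^ 2))); ring.
Qed.

(** The improper integral converges because the proper integral of [phi] is continuous in its two
    bounds, while [acos] tends to PI at -1 and to 0 at 1. The end -1 reduces to 1 through acos (-a)
    = PI - acos a. *)
Lemma is_RInt_gen_acos_subst (phi : R -> C) :
  (forall t, continuousC phi t) ->
  is_RInt_gen (V := C_R_CompleteNormedModule)
    (fun x => phi (acos x) / RtoC (sqrt (1 - x ^ 2)))
    (at_right (-1)) (at_left 1) (RIntC phi 0 PI).
Proof.
intros Hphi P HP.
assert (Hex : forall u v, ex_RIntC phi u v)
  by (intros; apply ex_RInt_continuous; intros; apply Hphi).
assert (Hc := continuous_RInt (V := C_R_CompleteNormedModule) phi 0 PI (RIntC phi)).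
assert (L : locally (0, PI)%R (fun z : R * R =>
   is_RIntC phi (fst z) (snd z) (RIntC phi (fst z) (snd z)))).
{ apply filter_forall; intros z; apply (RInt_correct (V := C_R_CompleteNormedModule)), Hex. }
destruct (Hc L P HP) as [e He].
destruct (acos_near_1 e (cond_pos e)) as [d [Hd0 Hd]].
assert (Ha : forall a, (-1 < a < -1 + d)%R -> (a < 1)%R /\ (PI - e < acos a < PI)%R).
{ intros a Ha; destruct (Hd (- a)%R ltac:(lra)) as [K1 K2].
  rewrite acos_opp in K2; lra. }
apply (Filter_prod _ _ _ (fun a => -1 < a < -1 + d)%R (fun b => 1 - d < b < 1)%R).
- exists (mkposreal d Hd0); intros y Hy Hy1.
  apply Rabs_lt_between in Hy; unfold minus, plus, opp in Hy; simpl in Hy; lra.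
- exists (mkposreal d Hd0); intros y Hy Hy1.
  apply Rabs_lt_between in Hy; unfold minus, plus, opp in Hy; simpl in Hy; lra.
- intros a b Ka Kb; exists (RIntC phi (acos b) (acos a)); split.
  + simpl; destruct (Ha a Ka), (Hd b Kb); apply is_RInt_acos_subst; try assumption; lra.
  + apply (He (acos b, acos a)); destruct (Ha a Ka), (Hd b Kb).
    split; apply Rabs_lt_between; unfold minus, plus, opp; simpl; lra.
Qed.

Lemma bernstein_point_1 (t : R) : bernstein_point 1 t = RtoC (cos t).
Proof.
rewrite bernstein_point_coord, Rinv_1; unfold RtoC; f_equal; field.
Qed.

Lemma cheb_coef_cos (f : C -> C) (n : nat) :
  (forall t, continuousC (fun t => f (RtoC (cos t))) t) ->
  cheb_coef f n =
  RtoC (2 / PI) * RIntC (fun t => f (RtoC (cos t)) * RtoC (cos (INR n * t))) 0 PI.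
Proof.
intros Hf; unfold cheb_coef; f_equal.
apply (is_RInt_gen_unique (V := C_R_CompleteNormedModule)).
assert (H := is_RInt_gen_acos_subst (fun t => f (RtoC (cos t)) * RtoC (cos (INR n * t)))).
specialize (H ltac:(intros t; apply continuousC_mult; [apply Hf|];
  apply continuousC_pair; simpl; [|apply continuous_const];
  apply (ex_derive_continuous (V := R_NormedModule)); auto_derive; exact I)).
refine (is_RInt_gen_ext _ _ _ _ H).
(* The two integrands are compared through cos (acos x) = x, so the bounds must be kept within
   [-1,1]. *)
apply (Filter_prod _ _ _ (fun a => -1 < a < 1)%R (fun b => -1 < b < 1)%R).
- exists (mkposreal 1 Rlt_0_1); intros y Hy Hy1.
  apply Rabs_lt_between in Hy; unfold minus, plus, opp in Hy; simpl in Hy; lra.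
- exists (mkposreal 1 Rlt_0_1); intros y Hy Hy1.
  apply Rabs_lt_between in Hy; unfold minus, plus, opp in Hy; simpl in Hy; lra.
- intros a b Ka Kb x Hx; simpl in Hx.
  assert (Hx' : (-1 <= x <= 1)%R).
  { unfold Rmin, Rmax in Hx; destruct (Rle_dec a b); lra. }
  now rewrite <- chebT_cos, cos_acos by assumption.
Qed.

(** The two halves of the circle are exchanged by complex conjugation,
    [t] becoming [2 PI - t]. *)
Lemma cheb_coef_circle (f : C -> C) (n : nat) :
  (forall t, continuousC (fun t => f (RtoC (cos t))) t) ->
  cheb_coef f n =
  RtoC (/ PI) * RIntC (fun t => f (bernstein_point 1 t) * expi (- (INR n * t))) 0 (2 * PI).
Proof.
intros Hf; rewrite cheb_coef_cos by assumption.
set (psi := fun t => f (RtoC (cos t)) * expi (- INR n * t)).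
assert (Hpsi : forall t, continuousC psi t).
{ intros t; apply continuousC_mult; [apply Hf|apply continuousC_expi]. }
assert (Hex : forall u v, ex_RIntC psi u v)
  by (intros; apply ex_RInt_continuous; intros; apply Hpsi).
rewrite (RInt_ext (V := C_R_CompleteNormedModule)
   (fun t => f (bernstein_point 1 t) * expi (- (INR n * t))) psi).
2:{ intros t _; unfold psi; rewrite bernstein_point_1; do 2 f_equal; ring. }
rewrite <- (RInt_Chasles (V := C_R_CompleteNormedModule) psi 0 PI (2 * PI)) by apply Hex.
(* The [opp] comes from the reversed bounds, the factor -1 from the derivative of the reflection. *)
assert (H1 : is_RIntC (fun t => opp (scal (-1) (psi (-1 * t + 2 * PI)%R))) 0 PI
   (RIntC psi PI (2 * PI))).
{ rewrite <- (opp_opp (RIntC psi PI (2 * PI))).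
  apply (is_RInt_opp (V := C_R_CompleteNormedModule)),
    (is_RInt_comp_lin (V := C_R_CompleteNormedModule)),
    (is_RInt_swap (V := C_R_CompleteNormedModule)).
  replace (-1 * 0 + 2 * PI)%R with (2 * PI)%R by ring.
  replace (-1 * PI + 2 * PI)%R with PI by ring.
  apply (RInt_correct (V := C_R_CompleteNormedModule)), Hex. }
assert (H2 := RInt_correct (V := C_R_CompleteNormedModule) psi 0 PI (Hex _ _)).
(* Half the sum of e^(-i n t) and its reflection e^(i n t) is cos (n t); the same 1/2 turns 2 / PI
   into 1 / PI. *)
assert (H3 := is_RIntC_Cmult _ _ _ (/ 2) _ (is_RInt_plus _ _ _ _ _ _ H2 H1)).
rewrite (is_RInt_unique (V := C_R_CompleteNormedModule) _ 0 PI
  (/ 2 * plus (RIntC psi 0 PI) (RIntC psi PI (2 * PI)))).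
- replace (/ PI)%R with (2 / PI * / 2)%R by (field; apply PI_neq0).
  rewrite RtoC_mult, RtoC_inv by lra; apply Cmult_assoc.
- refine (is_RInt_ext _ _ _ _ _ _ H3); intros t _.
  rewrite scal_R_Cmult; change opp with Copp; change plus with Cplus; unfold psi.
  replace (cos (-1 * t + 2 * PI)) with (cos t).
  2:{ rewrite <- (cos_neg t), <- (cos_period (- t) 1); f_equal; simpl; ring. }
  replace (expi (- INR n * (-1 * t + 2 * PI))) with (expi (INR n * t)).
  2:{ replace (- INR n * (-1 * t + 2 * PI))%R with
        (INR n * t + IZR (- Z.of_nat n) * (2 * PI))%R
        by (rewrite opp_IZR, <- INR_IZR_INZ; ring).
      rewrite expi_plus, expi_2PI_Z; ring. }
  replace (RtoC (cos (INR n * t))) with (/ 2 * (expi (- INR n * t) + expi (INR n * t))).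
  2:{ rewrite <- RtoC_inv by lra; unfold expi, Cmult, Cplus, RtoC; simpl.
      replace (- INR n * t)%R with (- (INR n * t))%R by ring.
      rewrite cos_neg, sin_neg; f_equal; field. }
  replace (RtoC (-1)) with (- RtoC 1) by now rewrite <- RtoC_opp.
  match goal with |- ?u = ?v => change (@eq C u v) end; ring.
Qed.

(** * Error of the trapezoidal rule *)

Lemma sum_n_m_Cmult_l (c : C) (a : nat -> C) (p q : nat) :
  sum_n_m (fun k => c * a k) p q = c * sum_n_m a p q :> C.
Proof. exact (sum_n_m_mult_l (K := C_Ring) c a p q). Qed.

Lemma sum_n_m_Cmult_r (c : C) (a : nat -> C) (p q : nat) :
  sum_n_m (fun k => a k * c) p q = sum_n_m a p q * c :> C.
Proof. exact (sum_n_m_mult_r (K := C_Ring) c a p q). Qed.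

(** Mean over a period minus average over the nodes. A relation carries integrability with it, so
    linearity holds without side conditions. *)
Definition is_trap_err (m : nat) (phi : R -> C) (e : C) : Prop :=
  exists I : C, is_RIntC phi 0 (2 * PI) I /\
    e = RtoC (/ (2 * PI)) * I -
        RtoC (/ INR m) * sum_n_m (fun j : nat => phi (2 * PI * INR j / INR m)%R) 0 (m - 1).

Lemma is_trap_err_ext (m : nat) (phi psi : R -> C) (e : C) :
  (forall t, phi t = psi t) -> is_trap_err m phi e -> is_trap_err m psi e.
Proof.
intros E [I [H ->]]; exists I; split.
- refine (is_RInt_ext _ _ _ _ _ _ H); intros; apply E.
- do 2 f_equal; apply sum_n_m_ext; intros; apply E.
Qed.

Lemma is_trap_err_plus (m : nat) (phi psi : R -> C) (e e' : C) :
  is_trap_err m phi e -> is_trap_err m psi e' ->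
  is_trap_err m (fun t => phi t + psi t) (e + e').
Proof.
intros [I [H ->]] [J [K ->]]; exists (I + J); split.
- exact (is_RInt_plus (V := C_R_CompleteNormedModule) _ _ _ _ _ _ H K).
- pose proof (sum_n_m_plus (G := C_AbelianMonoid)
    (fun j => phi (2 * PI * INR j / INR m)%R) (fun j => psi (2 * PI * INR j / INR m)%R) 0 (m - 1)) as E.
  change plus with Cplus in E; rewrite E; ring.
Qed.

Lemma is_trap_err_scal (m : nat) (phi : R -> C) (c e : C) :
  is_trap_err m phi e -> is_trap_err m (fun t => c * phi t) (c * e).
Proof.
intros [I [H ->]]; exists (c * I); split.
- now apply is_RIntC_Cmult.
- rewrite sum_n_m_Cmult_l; ring.
Qed.

Lemma is_trap_err_sum (m : nat) (phi : nat -> R -> C) (e : nat -> C) (N : nat) :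
  (forall k, (1 <= k <= N)%nat -> is_trap_err m (phi k) (e k)) ->
  is_trap_err m (fun t => sum_n_m (fun k => phi k t) 1 N) (sum_n_m e 1 N).
Proof.
induction N as [|N IH]; intros H.
- exists (RtoC 0); rewrite sum_n_m_zero by lia; split.
  + apply (is_RInt_ext (V := C_R_CompleteNormedModule) (fun _ => 0 * RtoC 0)).
    { intros t _; rewrite sum_n_m_zero by lia; apply Cmult_0_r. }
    pose proof (is_RIntC_Cmult _ _ _ 0 _
      (is_RInt_const (V := C_R_CompleteNormedModule) 0 (2 * PI) (RtoC 0))) as K.
    refine (eq_rect _ (is_RIntC _ 0 (2 * PI)) K _ (Cmult_0_l _)).
  + rewrite (sum_n_m_ext _ (fun _ => zero)) by (intros; apply sum_n_m_zero; lia).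
    rewrite sum_n_m_const_zero; change zero with (RtoC 0); ring.
- rewrite sum_n_Sm by lia.
  apply (is_trap_err_ext m (fun t => sum_n_m (fun k => phi k t) 1 N + phi (S N) t)).
  { intros t; rewrite sum_n_Sm by lia; reflexivity. }
  apply is_trap_err_plus; [apply IH; intros|]; apply H; lia.
Qed.

(** The mean and the node average are each at most M in modulus. *)
Lemma is_trap_err_bound (m : nat) (phi : R -> C) (e : C) (M : R) : (1 <= m)%nat ->
  (forall t, (0 <= t <= 2 * PI)%R -> (Cmod (phi t) <= M)%R) ->
  is_trap_err m phi e -> (Cmod e <= 2 * M)%R.
Proof.
intros Hm HM [I [H ->]]; pose proof PI_RGT_0 as HPI.
assert (Hm0 : (0 < INR m)%R) by (apply lt_0_INR; lia).
pose proof (is_RIntC_bound phi 0 (2 * PI) M I ltac:(lra) HM H) as B1.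
set (S := sum_n_m (fun j : nat => phi (2 * PI * INR j / INR m)%R) 0 (m - 1) : C).
assert (B2 : (Cmod S <= INR m * M)%R).
{ eapply Rle_trans; [apply (norm_sum_n_m (V := C_NormedModule))|].
  (* The comparison is demanded at every index; past m - 1 the node may leave [0, 2 PI], so there
     each term serves as its own bound. *)
  eapply Rle_trans; [apply (sum_n_m_le _ (fun j => if Nat.leb j (m - 1) then M
     else norm (phi (2 * PI * INR j / INR m)%R : C_NormedModule)))|].
  - intros j; destruct (Nat.leb_spec j (m - 1)) as [Hj|Hj]; [|apply Rle_refl].
    apply HM.
    assert (Hjm : (0 <= INR j <= INR m)%R) by (split; [apply pos_INR|apply le_INR; lia]).
    split; [apply Rdiv_le_0_compat; nra|].
    apply (Rmult_le_reg_r (INR m)); [assumption|].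
    replace (2 * PI * INR j / INR m * INR m)%R with (2 * PI * INR j)%R by (field; lra).
    nra.
  - rewrite (sum_n_m_ext_loc _ (fun _ => M)).
    + rewrite sum_n_m_const; apply Req_le; do 2 f_equal; lia.
    + intros j Hj; destruct (Nat.leb_spec j (m - 1)); [reflexivity|lia]. }
eapply Rle_trans; [apply Cmod_triangle|].
rewrite Cmod_opp, !Cmod_mult, !Cmod_R.
rewrite !Rabs_pos_eq by (left; apply Rinv_0_lt_compat; lra).
assert (/ (2 * PI) * Cmod I <= M)%R.
{ apply (Rmult_le_reg_l (2 * PI)); [lra|].
  rewrite <- Rmult_assoc, Rinv_r, Rmult_1_l by lra; lra. }
assert (/ INR m * Cmod S <= M)%R.
{ apply (Rmult_le_reg_l (INR m)); [lra|].
  rewrite <- Rmult_assoc, Rinv_r, Rmult_1_l by lra; lra. }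
lra.
Qed.

Lemma is_RIntC_expi_Z (p : Z) : p <> 0%Z ->
  is_RIntC (fun t => expi (IZR p * t)) 0 (2 * PI) (RtoC 0).
Proof.
intros Hp; assert (Hp0 : IZR p <> 0%R) by now apply not_0_IZR.
pose proof (expi_2PI_Z p) as E; unfold expi in E; injection E as E1 E2.
replace (RtoC 0) with
  ((sin (IZR p * (2 * PI)) / IZR p, - cos (IZR p * (2 * PI)) / IZR p)%R
   - (sin (IZR p * 0) / IZR p, - cos (IZR p * 0) / IZR p)%R).
2:{ rewrite E1, E2, Rmult_0_r, sin_0, cos_0.
    unfold Cminus, Cplus, Copp, RtoC; simpl; f_equal; field; assumption. }
apply (is_RIntC_Cderive (fun t => (sin (IZR p * t) / IZR p, - cos (IZR p * t) / IZR p)%R));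
  try (intros x; simpl; auto_derive; [assumption || exact I|field; assumption]).
intros x; apply continuousC_expi.
Qed.

Lemma is_trap_err_mode_0 (m : nat) (p : Z) : (1 <= m)%nat ->
  (p = 0 \/ ~ (Z.of_nat m | p))%Z ->
  is_trap_err m (fun t => expi (IZR p * t)) 0.
Proof.
intros Hm Hp; pose proof PI_RGT_0 as HPI.
assert (Hm0 : INR m <> 0%R) by (apply not_0_INR; lia).
destruct (Z.eq_dec p 0) as [->|Np].
- exists (RtoC (2 * PI - 0) * 1); split.
  + apply (is_RInt_ext (V := C_R_CompleteNormedModule) (fun _ => RtoC 1)).
    { intros t _; now rewrite Rmult_0_l, expi_0. }
    rewrite <- scal_R_Cmult; exact (is_RInt_const (V := C_R_CompleteNormedModule) _ _ _).
  + rewrite sum_expi_nodes_dvd, Cmult_1_r, <- !RtoC_mult, <- RtoC_minus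
      by (assumption || apply Z.divide_0_r).
    f_equal; field; split; lra.
- exists (RtoC 0); split; [now apply is_RIntC_expi_Z|].
  rewrite sum_expi_nodes by tauto; ring.
Qed.

(** Aliasing: the mode has mean 0 but equals 1 at every node. *)
Lemma is_trap_err_mode_dvd (m : nat) (p : Z) : (1 <= m)%nat ->
  p <> 0%Z -> (Z.of_nat m | p)%Z ->
  is_trap_err m (fun t => expi (IZR p * t)) (- (1)).
Proof.
intros Hm Np Hp.
assert (Hm0 : INR m <> 0%R) by (apply not_0_INR; lia).
exists (RtoC 0); split; [now apply is_RIntC_expi_Z|].
rewrite sum_expi_nodes_dvd by assumption.
rewrite (RtoC_inv (INR m)) by assumption; field.
intros K; apply Hm0; now apply RtoC_inj.
Qed.

Lemma small_not_divide (m p : Z) : (0 < Z.abs p < m)%Z -> ~ (m | p)%Z.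
Proof.
intros Hp [k ->]; rewrite Z.abs_mul in Hp.
assert (k = 0 \/ 1 <= k \/ k <= -1)%Z as [->|[K|K]] by lia; nia.
Qed.

Lemma between_not_divide (m p : Z) : (0 < p < 2 * m)%Z -> p <> m -> ~ (m | - p)%Z.
Proof. intros Hp Np [k Hk]; assert (k <= -1)%Z by nia; assert (-1 <= k)%Z by nia; nia. Qed.

(** Since |k - n| < m, the mode k - n is integrated exactly; since 0 <= k + n < 2 m, the mode -(k +
    n) aliases only when k + n = m. *)
Lemma is_trap_err_chebT (m n k : nat) (rho : R) : rho <> 0%R -> (n < m)%nat -> (k < m)%nat ->
  is_trap_err m (fun t => chebT k (bernstein_point rho t) * expi (- (INR n * t)))
    (if Nat.eqb (k + n) m then - (/ 2 * RtoC (/ rho ^ k)) else 0).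
Proof.
intros Hr Hn Hk.
eapply is_trap_err_ext; [intros t; symmetry; now apply chebT_bernstein_mode|].
assert (H1 : is_trap_err m (fun t => expi (IZR (Z.of_nat k - Z.of_nat n) * t)) 0).
{ apply is_trap_err_mode_0; [lia|].
  destruct (Z.eq_dec (Z.of_nat k - Z.of_nat n) 0) as [E|E]; [now left|right].
  apply small_not_divide; lia. }
assert (H2 : is_trap_err m (fun t => expi (IZR (- (Z.of_nat k + Z.of_nat n)) * t))
   (if Nat.eqb (k + n) m then - (1) else 0)).
{ destruct (Nat.eqb_spec (k + n) m) as [E|E].
  - apply is_trap_err_mode_dvd; [lia|lia|]; exists (-1)%Z; lia.
  - apply is_trap_err_mode_0; [lia|].
    destruct (Z.eq_dec (Z.of_nat k + Z.of_nat n) 0) as [E0|E0]; [left; lia|right].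
    apply between_not_divide; lia. }
pose proof (is_trap_err_scal _ _ (/ 2) _ (is_trap_err_plus _ _ _ _ _
  (is_trap_err_scal _ _ (RtoC (rho ^ k)) _ H1)
  (is_trap_err_scal _ _ (RtoC (/ rho ^ k)) _ H2))) as H.
replace (if Nat.eqb (k + n) m then - (/ 2 * RtoC (/ rho ^ k)) else 0) with
  (/ 2 * (RtoC (rho ^ k) * 0 + RtoC (/ rho ^ k) * (if Nat.eqb (k + n) m then - (1) else 0)));
  [exact H|].
destruct (Nat.eqb (k + n) m); ring.
Qed.

Lemma sum_n_m_all_zero (a : nat -> C) (p q : nat) :
  (forall k, (p <= k <= q)%nat -> a k = 0) -> sum_n_m a p q = RtoC 0 :> C.
Proof.
intros H; rewrite (sum_n_m_ext_loc (G := C_AbelianMonoid) a (fun _ => zero) p q H).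
exact (sum_n_m_const_zero (G := C_AbelianMonoid) p q).
Qed.

Lemma sum_n_m_single (a : nat -> C) (p q k0 : nat) : (p <= k0 <= q)%nat ->
  (forall k, (p <= k <= q)%nat -> k <> k0 -> a k = 0) -> sum_n_m a p q = a k0 :> C.
Proof.
intros Hk H.
rewrite (sum_n_m_Chasles a p k0 q) by lia.
rewrite (sum_n_m_all_zero a (S k0) q) by (intros; apply H; lia).
destruct k0 as [|k0].
- replace p with 0%nat by lia; rewrite sum_n_n; apply Cplus_0_r.
- rewrite sum_n_Sm by lia.
  rewrite (sum_n_m_all_zero a p k0) by (intros; apply H; lia).
  change plus with Cplus; ring.
Qed.

(** * From the quadrature error to the coefficients: the norm on the ellipse and the final bound *)

Lemma cheb_coef_sub_trap (f : C -> C) (m n : nat) (rho : R) (e : C) :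
  (1 <= rho)%R -> (1 <= m)%nat ->
  (forall z, bernstein_region rho z -> Cdiff_at f z) ->
  is_trap_err m (fun t => f (bernstein_point rho t) * expi (- (INR n * t))) e ->
  cheb_coef f n - cheb_coef_trap f m rho n = RtoC (2 / rho ^ n) * e.
Proof.
intros Hrho Hm Hf [I [HI ->]]; pose proof PI_RGT_0 as HPI.
assert (Hm0 : INR m <> 0%R) by (apply not_0_INR; lia).
assert (Hrn : (rho ^ n <> 0)%R) by (apply pow_nonzero; lra).
rewrite cheb_coef_circle.
(* Continuity is wanted at every real t, so [acos (cos t)] supplies a parameter in [0, PI] for the
   same point of the segment. *)
2:{ intros t; pose proof (COS_bound t) as Hb; pose proof (acos_bound (cos t)) as Ha.
  destruct (Hf (RtoC (cos t))) as [l Hl].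
  { rewrite <- (cos_acos (cos t)), <- bernstein_point_1 by assumption.
    apply bernstein_point_region; lra. }
  apply (continuousC_comp_deriveC f (fun t => RtoC (cos t)) t l Hl).
  apply continuousC_pair; simpl; [|apply continuous_const].
  apply (ex_derive_continuous (V := R_NormedModule)); auto_derive; exact Logic.I. }
rewrite (contour_shift rho f n Hrho Hf).
rewrite (is_RInt_unique (V := C_R_CompleteNormedModule) _ _ _ _ HI).
unfold cheb_coef_trap.
rewrite (sum_n_m_ext _ (fun j : nat => f (bernstein_point rho (2 * PI * INR j / INR m)) *
       expi (- (INR n * (2 * PI * INR j / INR m))))).
2:{ intros j; do 2 f_equal; field; assumption. }
generalize (sum_n_m (fun j : nat => f (bernstein_point rho (2 * PI * INR j / INR m)) *
       expi (- (INR n * (2 * PI * INR j / INR m)))) 0 (m - 1) : C); intros S.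
replace (/ PI)%R with (2 * / (2 * PI))%R by (field; lra).
replace (2 / (INR m * rho ^ n))%R with (2 * / rho ^ n * / INR m)%R by (field; now split).
unfold Rdiv; rewrite !RtoC_mult; ring.
Qed.

(** Since [real] sends infinite values to 0, the least upper bound must be shown finite: [g] is
    continuous along the compact parameter interval, hence bounded on the ellipse. *)
Lemma ellipse_norm_ub (rho : R) (g : C -> C) (z : C) :
  (1 <= rho)%R -> (forall z, bernstein_region rho z -> Cdiff_at g z) ->
  bernstein_ellipse rho z -> (Cmod (g z) <= ellipse_norm rho g)%R.
Proof.
intros Hrho Hg Hz.
destruct (bounded_continuity (V := C_R_NormedModule) (fun t => g (bernstein_point rho t)) 0 (2 * PI))
  as [M HM].
{ intros t Ht; destruct (Hg (bernstein_point rho t)) as [l Hl].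
  { apply bernstein_point_region; lra. }
  apply (continuousC_comp_deriveC g (bernstein_point rho) t l Hl).
  apply continuousC_pair; unfold bernstein_point, expi; simpl;
    apply (ex_derive_continuous (V := R_NormedModule)); auto_derive; exact I. }
unfold ellipse_norm.
set (E := fun r : R => exists z : C, bernstein_ellipse rho z /\ r = Cmod (g z)).
destruct (Lub_Rbar_correct E) as [Hub Hl].
assert (Hr : Rbar_le (Finite (Cmod (g z))) (Lub_Rbar E)) by (apply Hub; now exists z).
assert (HB : Rbar_le (Lub_Rbar E) (Finite M)).
{ apply Hl; intros r [w [[t [Ht ->]] ->]]; simpl; rewrite Cmod_norm; left; now apply HM. }
destruct (Lub_Rbar E); simpl in *; tauto.
Qed.

Lemma Cdiff_chebT (k : nat) (z : C) : Cdiff_at (chebT k) z.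
Proof.
cut (Cdiff_at (chebT k) z /\ Cdiff_at (chebT (S k)) z); [tauto|].
induction k as [|k [IH0 IH1]].
- split; [exact (Cdiff_const 1 z)|exact (Cdiff_id z)].
- split; [exact IH1|].
  apply (Cdiff_ext (fun w => 2 * w * chebT (S k) w + - (1) * chebT k w)).
  { intros w; rewrite chebT_SS; ring. }
  apply Cdiff_plus; [|now apply Cdiff_scal].
  apply Cdiff_mult; [|exact IH1]; apply Cdiff_scal, Cdiff_id.
Qed.

Lemma Cdiff_cheb_sum (eta : nat -> C) (N : nat) (z : C) :
  Cdiff_at (fun z => sum_n_m (fun k : nat => eta k * chebT k z) 1 N) z.
Proof.
induction N as [|N IH].
- apply (Cdiff_ext (fun _ => RtoC 0)); [|apply Cdiff_const].
  intros w; rewrite sum_n_m_zero by lia; reflexivity.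
- apply (Cdiff_ext (fun w => sum_n_m (fun k : nat => eta k * chebT k w) 1 N
     + eta (S N) * chebT (S N) w)).
  { intros w; rewrite sum_n_Sm by lia; reflexivity. }
  apply Cdiff_plus; [exact IH|]; apply Cdiff_scal, Cdiff_chebT.
Qed.

Lemma is_trap_err_cheb_sum (eta : nat -> C) (m n : nat) (rho : R) :
  rho <> 0%R -> (n < m)%nat ->
  is_trap_err m (fun t =>
    (eta 0%nat / 2 + sum_n_m (fun k : nat => eta k * chebT k (bernstein_point rho t)) 1 (m - 1))
    * expi (- (INR n * t)))
  (if Nat.eqb n 0 then 0 else - (eta (m - n)%nat * (/ 2 * RtoC (/ rho ^ (m - n))))).
Proof.
intros Hr Hn.
set (e := fun k => if Nat.eqb (k + n) m then - (/ 2 * RtoC (/ rho ^ k)) else 0).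
assert (He : forall k, (k < m)%nat ->
  is_trap_err m (fun t => chebT k (bernstein_point rho t) * expi (- (INR n * t))) (e k)).
{ intros k Hk; now apply is_trap_err_chebT. }
assert (Hsum : sum_n_m (fun k => eta k * e k) 1 (m - 1) =
  (if Nat.eqb n 0 then 0 else - (eta (m - n)%nat * (/ 2 * RtoC (/ rho ^ (m - n))))) :> C).
{ destruct (Nat.eqb_spec n 0) as [E0|E0].
  - apply sum_n_m_all_zero; intros k Hk; unfold e.
    destruct (Nat.eqb_spec (k + n) m); [lia|ring].
  - rewrite (sum_n_m_single _ 1 (m - 1) (m - n)%nat); [|lia|].
    + unfold e; replace (m - n + n)%nat with m by lia; rewrite Nat.eqb_refl; ring.
    + intros k Hk Nk; unfold e; destruct (Nat.eqb_spec (k + n) m); [lia|ring]. }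
rewrite <- Hsum.
replace (sum_n_m (fun k => eta k * e k) 1 (m - 1) : C) with
  (eta 0%nat / 2 * e 0%nat + sum_n_m (fun k => eta k * e k) 1 (m - 1)).
(* The halved constant term is integrated without error, since 0 + n = m contradicts n < m. *)
2:{ unfold e at 1; destruct (Nat.eqb_spec (0 + n) m); [lia|]; ring. }
apply (is_trap_err_ext m (fun t =>
  eta 0%nat / 2 * (chebT 0 (bernstein_point rho t) * expi (- (INR n * t))) +
  sum_n_m (fun k => eta k * (chebT k (bernstein_point rho t) * expi (- (INR n * t)))) 1 (m - 1))).
{ intros t; rewrite Cmult_plus_distr_r; f_equal.
  - unfold chebT; simpl; ring.
  - rewrite <- sum_n_m_Cmult_r.
    apply sum_n_m_ext; intros k; apply Cmult_assoc. }
apply is_trap_err_plus; [apply is_trap_err_scal, He; lia|].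
apply (is_trap_err_sum m (fun k t => eta k * (chebT k (bernstein_point rho t) * expi (- (INR n * t))))
  (fun k => eta k * e k)).
intros k Hk; apply is_trap_err_scal, He; lia.
Qed.

(** The errors on [f - s] and on [s] are known separately; by linearity their sum is the error on
    [f], and the factor [2 / rho ^ n] is applied to both at the end. *)
Lemma cheb_coef_trap_error (rho : R) (f s : C -> C) (m n : nat) (eta : nat -> C) :
  (1 <= rho)%R -> (n < m)%nat ->
  (forall z : C, bernstein_region rho z -> analytic_at f z) ->
  (forall z : C, s z = eta 0%nat / 2 +
      sum_n_m (fun k : nat => eta k * chebT k z) 1 (m - 1)) ->
  (Cmod (cheb_coef f n - cheb_coef_trap f m rho n)
   <= 4 / rho ^ n * ellipse_norm rho (fun z => (f z - s z)%C)
      + (if Nat.eqb n 0 then 0 else Cmod (eta (m - n)%nat) / rho ^ m))%R.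
Proof.
intros Hrho Hn Hf Hs; pose proof PI_RGT_0 as HPI.
assert (Hf' : forall z, bernstein_region rho z -> Cdiff_at f z)
  by (intros; now apply Cdiff_of_analytic, Hf).
set (g := fun z => f z - s z).
assert (Hg : forall z, bernstein_region rho z -> Cdiff_at g z).
{ intros z Hz; apply (Cdiff_ext (fun w => f w + - (1) * (eta 0%nat / 2 +
    sum_n_m (fun k : nat => eta k * chebT k w) 1 (m - 1)))).
  { intros w; unfold g; rewrite Hs; ring. }
  apply Cdiff_plus; [now apply Hf'|]; apply Cdiff_scal, Cdiff_plus;
    [apply Cdiff_const|apply Cdiff_cheb_sum]. }
assert (Hge : exists e, is_trap_err m
   (fun t => g (bernstein_point rho t) * expi (- (INR n * t))) e).
{ destruct (ex_RInt_continuous (V := C_R_CompleteNormedModule)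
    (fun t => g (bernstein_point rho t) * expi (- (INR n * t))) 0 (2 * PI)) as [I HI].
  - intros t Ht; rewrite Rmin_left, Rmax_right in Ht by lra.
    apply bernstein_integrand_continuous with rho; try assumption; lra.
  - eexists; exists I; split; [exact HI|reflexivity]. }
destruct Hge as [e He].
assert (Be : (Cmod e <= 2 * ellipse_norm rho g)%R).
{ apply (is_trap_err_bound m (fun t => g (bernstein_point rho t) * expi (- (INR n * t))));
    [lia| |exact He].
  intros t Ht; rewrite Cmod_mult, Cmod_expi, Rmult_1_r.
  apply ellipse_norm_ub; try assumption; now exists t. }
pose proof (is_trap_err_cheb_sum eta m n rho ltac:(lra) Hn) as Hse.
set (es := if Nat.eqb n 0 then RtoC 0
  else - (eta (m - n)%nat * (/ 2 * RtoC (/ rho ^ (m - n))))) in Hse.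
assert (Hfe : is_trap_err m (fun t => f (bernstein_point rho t) * expi (- (INR n * t))) (e + es)).
{ refine (is_trap_err_ext _ _ _ _ _ (is_trap_err_plus _ _ _ _ _ He Hse)).
  intros t; unfold g; rewrite Hs; ring. }
rewrite (cheb_coef_sub_trap f m n rho _ Hrho ltac:(lia) Hf' Hfe).
assert (Hrn : (0 < rho ^ n)%R) by (apply pow_lt; lra).
assert (Hc : (0 <= 2 / rho ^ n)%R) by (apply Rdiv_le_0_compat; lra).
rewrite Cmod_mult, Cmod_R, Rabs_pos_eq by assumption.
assert (Bs : (2 / rho ^ n * Cmod es <=
   if Nat.eqb n 0 then 0 else Cmod (eta (m - n)%nat) / rho ^ m)%R).
{ unfold es; destruct (Nat.eqb_spec n 0) as [E|E].
  - rewrite Cmod_0; lra.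
  - assert (Hrk : (0 < rho ^ (m - n))%R) by (apply pow_lt; lra).
    (* The normalisation [2 / rho ^ n] meets the weight [rho^(-(m-n)) / 2] of the aliased mode; the
       factors 2 and 1/2 cancel. *)
    replace (rho ^ m)%R with (rho ^ n * rho ^ (m - n))%R by (rewrite <- pow_add; f_equal; lia).
    rewrite Cmod_opp, !Cmod_mult, <- RtoC_inv, !Cmod_R, !Rabs_pos_eq
      by (try lra; left; apply Rinv_0_lt_compat; lra).
    right; field; split; lra. }
pose proof (Cmod_triangle e es) as T.
replace (4 / rho ^ n * ellipse_norm rho g)%R with
  (2 / rho ^ n * (2 * ellipse_norm rho g))%R by (field; lra).
eapply Rle_trans; [apply Rmult_le_compat_l; [exact Hc|exact T]|].
rewrite Rmult_plus_distr_l; apply Rplus_le_compat; [|exact Bs].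
now apply Rmult_le_compat_l.
Qed.

Theorem theorem3p1 (rho : R) (f : C -> C) (m : nat)
    (eta : nat -> C) (s : C -> C)
    (Hrho : (1 <= rho)%R)
    (Hf : forall z : C, bernstein_region rho z -> analytic_at f z)
    (Hm : (1 <= m)%nat)
    (Hs : best_approx rho (m - 1) f s)
    (Heta : forall z : C,
       s z = (eta 0%nat / 2 +
              sum_n_m (fun k : nat => eta k * chebT k z) 1 (m - 1))%C) :
  (forall n : nat, (1 <= n < m)%nat ->
     (Cmod (cheb_coef f n - cheb_coef_trap f m rho n)
      <= 4 / rho ^ n * ellipse_norm rho (fun z => (f z - s z)%C)
         + Cmod (eta (m - n)%nat) / rho ^ m)%R) /\
  (Cmod (cheb_coef f 0 - cheb_coef_trap f m rho 0)
   <= 4 * ellipse_norm rho (fun z => (f z - s z)%C))%R.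
Proof.
split.
- intros n Hn.
  pose proof (cheb_coef_trap_error rho f s m n eta Hrho ltac:(lia) Hf Heta) as H.
  destruct (Nat.eqb_spec n 0); [lia|exact H].
- pose proof (cheb_coef_trap_error rho f s m 0 eta Hrho ltac:(lia) Hf Heta) as H.
  simpl in H; lra.
Qed.
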